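(* Let $(A,\Delta)$ be an algebraic quantum group with antipode $S$ and let $h$ be a group-like projection in $A$. Let $C$ be the right leg of $\Delta(h)$, let $C_1=C\cap S(C)$, and let $\Delta_1$ be the coproduct on $C_1$ defined by $\Delta_1(a)=(E\otimes\iota)\Delta(a)$, where $E(a)=(\iota\otimes\varphi)(\Delta(a)(1\otimes h))$. Then $(C_1,\Delta_1)$ is an algebraic quantum hypergroup of discrete type.
   Context: Algebras are over $\mathbb C$, possibly without identity, with non-degenerate product; $\otimes$ is the algebraic tensor product, $M(A)$ is the multiplier algebra of $A$, $\iota$ is the identity map. A multiplier Hopf $^*$-algebra is a $^*$-algebra $A$ with a non-degenerate coassociative $^*$-homomorphism $\Delta:A\to M(A\otimes A)$ such that $a\otimes b\mapsto\Delta(a)(1\otimes b)$ and $a\otimes b\mapsto(a\otimes1)\Delta(b)$ are bijections from $A\otimes A$ onto $A\otimes A$. It has a unique counit $\varepsilon$ and a unique antipode $S$. An algebraic quantum group is a multiplier Hopf $^*$-algebra with a positive left integral $\varphi$ (non-zero, $\varphi(a^*a)\ge0$, $(\iota\otimes\varphi)\Delta(a)=\varphi(a)1$); then a positive right integral $\psi$ ($(\psi\otimes\iota)\Delta(a)=\psi(a)1$) also exists. A group-like projection is a non-zero $h\in A$ with $h^2=h=h^*$ and $\Delta(h)(1\otimes h)=h\otimes h$. The integrals are normalized so that $\varphi(h)=\psi(h)=1$. The right leg of $\Delta(h)$ is the smallest subspace $C$ of $A$ with $\Delta(h)(a\otimes1)\in A\otimes C$ for all $a\in A$; it is a $^*$-subalgebra,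 and $C_1=C\cap S(C)$ is a $^*$-subalgebra with $AC_1=A=C_1A$. The map $E:A\to A$ is a conditional expectation onto $C$ (so $E(cac')=cE(a)c'$ for $c,c'\in C$), and $E':A\to A$, $E'(a)=(\psi\otimes\iota)(\Delta(a)(h\otimes1))$, is a conditional expectation onto $S(C)$. For $a\in C_1$ the multiplier $\Delta_1(a)\in M(C_1\otimes C_1)$ is determined by $\Delta_1(a)(1\otimes b)=(E\otimes\iota)(\Delta(a)(1\otimes b))$ and $(1\otimes b)\Delta_1(a)=(E\otimes\iota)((1\otimes b)\Delta(a))$ for $b\in C_1$; equivalently $\Delta_1(a)=(\iota\otimes E')\Delta(a)$, and $\Delta_1(a)(1\otimes b)$, $\Delta_1(a)(b\otimes1)\in C_1\otimes C_1$ for $a,b\in C_1$. An algebraic quantum hypergroup is a pair $(D,\Delta)$ of an algebra $D$ with non-degenerate product and a linear map $\Delta:D\to M(D\otimes D)$ (not necessarily a homomorphism) such that: (1) the elements $\Delta(a)(1\otimes b)$, $(a\otimes1)\Delta(b)$, $\Delta(a)(b\otimes1)$, $(1\otimes a)\Delta(b)$ all lie in $D\otimes D$; (2) $\Delta$ is coassociative: $(c\otimes1\otimes1)(\Delta\otimes\iota)(\Delta(a)(1\otimes b))=(\iota\otimes\Delta)((c\otimes1)\Delta(a))(1\otimes1\otimes b)$ for all $a,b,c\in D$; (3) there is a counit, i.e. a homomorphism $\varepsilon:D\to\mathbb C$ with $(\varepsilon\otimes\iota)\Delta(a)=a=(\iota\otimes\varepsilon)\Delta(a)$ for all $a$; (4)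 there is a faithful left invariant functional $\varphi$ on $D$: $(\iota\otimes\varphi)\Delta(a)=\varphi(a)1$ for all $a$, and $b=0$ whenever $\varphi(ab)=0$ for all $a$ or $\varphi(ba)=0$ for all $a$; (5) there is an antipode relative to $\varphi$, i.e. a bijective anti-homomorphism $S:D\to D$ with $S\big((\iota\otimes\varphi)(\Delta(a)(1\otimes b))\big)=(\iota\otimes\varphi)((1\otimes a)\Delta(b))$ for all $a,b\in D$. It is of discrete type if there is a co-integral: a non-zero $k\in D$ with $ak=\varepsilon(a)k$ for all $a\in D$. *)

(* Defs.v *)
From HB Require Import structures.
From mathcomp Require Import all_boot all_order all_algebra generic_quotient.
From mathcomp Require Import sesquilinear complex.
From mathcomp Require Import boolp classical_sets functions reals.

Set Implicit Arguments.
Unset Strict Implicit.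
Unset Printing Implicit Defensive.

Import Order.TTheory GRing.Theory Num.Theory.
Local Open Scope ring_scope.
Local Open Scope quotient_scope.

Reserved Notation "a ** b" (at level 40, left associativity).
Reserved Notation "a \ox b" (at level 40, left associativity).
Reserved Notation "m \oxm n" (at level 40, left associativity).

HB.mixin Record isNuAlg (K : fieldType) A of GRing.Lmodule K A := {
  numul : A -> A -> A;
  numulA : associative numul;
  numulDl : left_distributive numul +%R;
  numulDr : right_distributive numul +%R;
  numulZl : forall (k : K) (a b : A), numul (k *: a) b = k *: numul a b;
  numulZr : forall (k : K) (a b : A), numul a (k *: b) = k *: numul a b
}.
#[short(type="nuAlgType")]
HB.structure Definition NuAlg (K : fieldType) :=
  {A of isNuAlg K A & GRing.Lmodule K A}.

Notation "a ** b" := (numul a b) : ring_scope.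

HB.mixin Record NuAlg_isStar (K : numClosedFieldType) A of NuAlg K A := {
  star : A -> A;
  starK : involutive star;
  starD : {morph star : a b / a + b};
  starZ : forall (k : K) (a : A), star (k *: a) = k^* *: star a;
  starM : forall a b : A, star (a ** b) = star b ** star a
}.
#[short(type="starAlgType")]
HB.structure Definition StarAlg (K : numClosedFieldType) :=
  {A of NuAlg_isStar K A & NuAlg K A}.

Definition nondegenerate (K : fieldType) (A : nuAlgType K) : Prop :=
  forall a : A, ((forall b, a ** b = 0) -> a = 0) /\
                ((forall b, b ** a = 0) -> a = 0).

Section NuAlgTheory.
Variables (K : fieldType) (A : nuAlgType K).

Lemma numul_bilinear : bilinear_for *:%R *:%R (@numul K A).
Proof.
split=> a k x y /=; first by rewrite numulDl numulZl.
by rewrite numulDr numulZr.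
Qed.

Lemma numul0l (a : A) : 0 ** a = 0.
Proof. by have := numulZl 0 0 a; rewrite !scale0r. Qed.

Lemma numul0r (a : A) : a ** 0 = 0.
Proof. by have := numulZr 0 a 0; rewrite !scale0r. Qed.

End NuAlgTheory.

(** A formal sum [:: (a_1, b_1); ...; (a_n, b_n)] stands for
    a_1 (x) b_1 + ... + a_n (x) b_n; two of them are identified when no bilinear
    map separates them.  Scalars need not be recorded, since
    k (a (x) b) = (k a) (x) b.  The universal property is [tlift_tens],
    [tlift_is_linear] and [tensor_ext] below. *)

Section TensorType.
Variables (K : fieldType) (A B : lmodType K).

Definition tsum (V : zmodType) (f : A -> B -> V) (s : seq (A * B)) : V :=
  \sum_(p <- s) f p.1 p.2.

Definition tequiv (s t : seq (A * B)) : bool :=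
  `[< forall (V : lmodType K) (f : A -> B -> V),
      bilinear_for *:%R *:%R f -> tsum f s = tsum f t >].

Lemma tequiv_refl : reflexive tequiv.
Proof. by move=> s; apply/asboolP. Qed.

Lemma tequiv_sym : symmetric tequiv.
Proof. by move=> s t; apply/asboolP/asboolP=> H V f /H. Qed.

Lemma tequiv_trans : transitive tequiv.
Proof.
by move=> s t u /asboolP H1 /asboolP H2; apply/asboolP=> V f bf; rewrite H1 ?H2.
Qed.

Canonical tequiv_rel := EquivRel tequiv tequiv_refl tequiv_sym tequiv_trans.

Definition tensor : Type := {eq_quot tequiv_rel}.
HB.instance Definition _ := Choice.on tensor.
HB.instance Definition _ := EqQuotient.on tensor.

Definition tens (a : A) (b : B) : tensor := \pi_tensor [:: (a, b)].

(* Meaningful for bilinear [f] only: [f] is summed over a chosen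
   representative of [x]. *)
Definition tlift (V : zmodType) (f : A -> B -> V) (x : tensor) : V :=
  tsum f (repr x).

Lemma tlift_pi (V : lmodType K) (f : A -> B -> V) (s : seq (A * B)) :
  bilinear_for *:%R *:%R f -> tlift f (\pi_tensor s) = tsum f s.
Proof.
move=> bf; rewrite /tlift; case: piP => t /eqmodP /asboolP H.
by rewrite (H V f bf).
Qed.

Lemma tensor_eqP (x y : tensor) :
  (forall (V : lmodType K) (f : A -> B -> V),
     bilinear_for *:%R *:%R f -> tlift f x = tlift f y) -> x = y.
Proof.
move=> H; rewrite -[x]reprK -[y]reprK; apply/eqmodP/asboolP => V f bf.
exact: H.
Qed.

Definition tadd (x y : tensor) : tensor := \pi_tensor (repr x ++ repr y).
Definition tscale (k : K) (x : tensor) : tensor :=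
  \pi_tensor [seq (k *: p.1, p.2) | p <- repr x].

Lemma tlift_add (V : lmodType K) (f : A -> B -> V) x y :
  bilinear_for *:%R *:%R f -> tlift f (tadd x y) = tlift f x + tlift f y.
Proof. by move=> bf; rewrite tlift_pi// /tsum big_cat. Qed.

Lemma tlift_scale (V : lmodType K) (f : A -> B -> V) k x :
  bilinear_for *:%R *:%R f -> tlift f (tscale k x) = k *: tlift f x.
Proof.
move=> bf; rewrite tlift_pi// /tsum big_map scaler_sumr; apply: eq_bigr => p _ /=.
have f0 b : f 0 b = 0.
  have := bf.1 b (-1) 0 0; rewrite /= scaler0 addr0 => E.
  by rewrite {}E scaleN1r addrC subrr.
by have := bf.1 p.2 k p.1 0; rewrite /= addr0 f0 addr0.
Qed.

Lemma tlift_zero (V : lmodType K) (f : A -> B -> V) :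
  bilinear_for *:%R *:%R f -> tlift f (\pi_tensor [::]) = 0.
Proof. by move=> bf; rewrite tlift_pi// /tsum big_nil. Qed.

Let taddA : associative tadd.
Proof. by move=> x y z; apply: tensor_eqP => V f bf; rewrite !tlift_add// addrA. Qed.
Let taddC : commutative tadd.
Proof. by move=> x y; apply: tensor_eqP => V f bf; rewrite !tlift_add// addrC. Qed.
Let tadd0 : left_id (\pi_tensor [::]) tadd.
Proof.
by move=> x; apply: tensor_eqP => V f bf; rewrite tlift_add// tlift_zero// add0r.
Qed.
Let taddN : left_inverse (\pi_tensor [::]) (tscale (-1)) tadd.
Proof.
move=> x; apply: tensor_eqP => V f bf.
by rewrite tlift_add// tlift_zero// tlift_scale// scaleN1r addNr.
Qed.
HB.instance Definition _ := GRing.isZmodule.Build tensor taddA taddC tadd0 taddN.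

Let tscaleA a b x : tscale a (tscale b x) = tscale (a * b) x.
Proof. by apply: tensor_eqP => V f bf; rewrite !tlift_scale// scalerA. Qed.
Let tscale1 : left_id 1 tscale.
Proof. by move=> x; apply: tensor_eqP => V f bf; rewrite tlift_scale// scale1r. Qed.
Let tscaleDr : right_distributive tscale +%R.
Proof.
move=> k x y; apply: tensor_eqP => V f bf.
by rewrite !(tlift_scale, tlift_add)// scalerDr.
Qed.
Let tscaleDl x : {morph tscale^~ x : a b / a + b}.
Proof.
move=> a b; apply: tensor_eqP => V f bf.
by rewrite !(tlift_scale, tlift_add)// scalerDl.
Qed.
HB.instance Definition _ :=
  GRing.Zmodule_isLmodule.Build K tensor tscaleA tscale1 tscaleDr tscaleDl.

End TensorType.

Notation "a \ox b" := (tens a b) : ring_scope.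

Section TensorTheory.
Variables (K : fieldType) (A B : lmodType K).
Implicit Types (x y : tensor A B).

Lemma tlift_is_linear (V : lmodType K) (f : A -> B -> V) :
  bilinear_for *:%R *:%R f -> linear (tlift f).
Proof. by move=> bf k x y; rewrite tlift_add// tlift_scale. Qed.

Lemma tlift_tens (V : lmodType K) (f : A -> B -> V) a b :
  bilinear_for *:%R *:%R f -> tlift f (a \ox b) = f a b.
Proof. by move=> bf; rewrite tlift_pi// /tsum big_seq1. Qed.

Lemma tens_bilinear : bilinear_for *:%R *:%R (@tens K A B).
Proof.
split=> c k u v; apply: tensor_eqP => V f bf;
  rewrite tlift_is_linear// !tlift_tens//.
- exact: (bf.1 c k u v).
- exact: (bf.2 c k u v).
Qed.

Lemma tensor_sum x : x = \sum_(p <- repr x) p.1 \ox p.2.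
Proof.
apply: tensor_eqP => V f bf; rewrite -[in LHS](reprK x) tlift_pi//.
elim: (repr x) => [|p s IHs]; first by rewrite /tsum !big_nil tlift_zero.
by rewrite /tsum !big_cons [tlift _ _]tlift_add// tlift_tens// -IHs.
Qed.

Lemma tensor_ind (P : tensor A B -> Prop) :
  P 0 -> (forall x y, P x -> P y -> P (x + y)) -> (forall a b, P (a \ox b)) ->
  forall x, P x.
Proof.
move=> P0 PD Pt x; rewrite (tensor_sum x).
by elim/big_ind: _ => // p _; apply: Pt.
Qed.

Lemma tensor_ext (V : lmodType K) (f g : tensor A B -> V) :
  linear f -> linear g -> (forall a b, f (a \ox b) = g (a \ox b)) -> f =1 g.
Proof.
move=> lf lg fg.
have f0 (h : tensor A B -> V) : linear h -> h 0 = 0.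
  by move=> lh; have := lh (-1) 0 0; rewrite scaler0 addr0 scaleN1r addNr.
have fD (h : tensor A B -> V) : linear h -> {morph h : x y / x + y}.
  by move=> lh x y; have := lh 1 x y; rewrite !scale1r.
elim/tensor_ind=> [|x y IHx IHy|//]; first by rewrite !f0.
by rewrite !fD// IHx IHy.
Qed.

(* [tlift f] depends linearly on [f]. *)
Lemma tlift_lin (V W : lmodType K) (g : W -> A -> B -> V) x :
  (forall a b, linear (fun w => g w a b)) -> linear (fun w => tlift (g w) x).
Proof.
move=> lg k u v; rewrite /tlift /tsum scaler_sumr -big_split /=.
by apply: eq_bigr => p _; rewrite lg.
Qed.

End TensorTheory.

(* f (x) g; meaningful for linear f and g only *)
Definition tmap (K : fieldType) (A B A' B' : lmodType K)
    (f : A -> A') (g : B -> B') : tensor A B -> tensor A' B' :=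
  tlift (fun a b => f a \ox g b).

(* w (x) iota and iota (x) w, for a linear functional w *)
Definition lslice (K : fieldType) (A B : lmodType K) (w : A -> K) :
  tensor A B -> B := tlift (fun a b => w a *: b).
Definition rslice (K : fieldType) (A B : lmodType K) (w : B -> K) :
  tensor A B -> A := tlift (fun a b => w b *: a).

Definition tassoc (K : fieldType) (A B D : lmodType K) :
    tensor (tensor A B) D -> tensor A (tensor B D) :=
  tlift (fun x d => tlift (fun a b => a \ox (b \ox d)) x).

Section TMap.
Variables (K : fieldType) (A B A' B' : lmodType K).

Lemma tmap_bilinear (f : A -> A') (g : B -> B') : linear f -> linear g ->
  bilinear_for *:%R *:%R (fun a b => f a \ox g b).
Proof.
have [bl br] := @tens_bilinear K A' B'.
move=> lf lg; split=> c k u v /=.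
- by rewrite lf; apply: bl.
- by rewrite lg; apply: br.
Qed.

Lemma tmap_tens (f : A -> A') (g : B -> B') a b : linear f -> linear g ->
  tmap f g (a \ox b) = f a \ox g b.
Proof. by move=> lf lg; rewrite /tmap tlift_tens//; apply: tmap_bilinear. Qed.

Lemma tmap_is_linear (f : A -> A') (g : B -> B') : linear f -> linear g ->
  linear (tmap f g).
Proof. by move=> lf lg; apply/tlift_is_linear/tmap_bilinear. Qed.

End TMap.

Section TensorAlg.
Variables (K : fieldType) (A B : nuAlgType K).

Definition tmul (x y : tensor A B) : tensor A B :=
  tlift (fun a b => tlift (fun c d => (a ** c) \ox (b ** d)) y) x.

Let inner_bil a b :
  bilinear_for *:%R *:%R (fun (c : A) (d : B) => (a ** c) \ox (b ** d)).
Proof. by apply: tmap_bilinear => k u v; rewrite numulDr numulZr. Qed.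

Let outer_bil (y : tensor A B) : bilinear_for *:%R *:%R
  (fun (a : A) (b : B) => tlift (fun c d => (a ** c) \ox (b ** d)) y).
Proof.
have [bl br] := @tens_bilinear K A B.
split=> e.
- apply: (tlift_lin (g := fun a c d => (a ** c) \ox (e ** d))) => c d k u v.
  by rewrite numulDl numulZl; apply: bl.
- apply: (tlift_lin (g := fun b c d => (e ** c) \ox (b ** d))) => c d k u v.
  by rewrite numulDl numulZl; apply: br.
Qed.

Lemma tmul_tens a b c d : tmul (a \ox b) (c \ox d) = (a ** c) \ox (b ** d).
Proof. by rewrite /tmul tlift_tens// tlift_tens. Qed.

Let tmul_linl y : linear (tmul^~ y).
Proof. exact: tlift_is_linear. Qed.
Let tmul_linr x : linear (tmul x).
Proof.
apply: (tlift_lin (g := fun y a b => tlift (fun c d => (a ** c) \ox (b ** d)) y)).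
by move=> a b; apply: tlift_is_linear.
Qed.

Let tmulDl : left_distributive tmul +%R.
Proof. by move=> x y z; have := tmul_linl z 1 x y; rewrite !scale1r. Qed.
Let tmulDr : right_distributive tmul +%R.
Proof. by move=> x y z; have := tmul_linr x 1 y z; rewrite !scale1r. Qed.
Let tmul0l x : tmul 0 x = 0.
Proof. by have := tmul_linl x (-1) 0 0; rewrite scaler0 addr0 scaleN1r addNr. Qed.
Let tmul0r x : tmul x 0 = 0.
Proof. by have := tmul_linr x (-1) 0 0; rewrite scaler0 addr0 scaleN1r addNr. Qed.
Let tmulZl k x y : tmul (k *: x) y = k *: tmul x y.
Proof. by have := tmul_linl y k x 0; rewrite !addr0 tmul0l addr0. Qed.
Let tmulZr k x y : tmul x (k *: y) = k *: tmul x y.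
Proof. by have := tmul_linr x k y 0; rewrite !addr0 tmul0r addr0. Qed.

Let tmulA : associative tmul.
Proof.
move=> x y z; elim/tensor_ind: x => [|x x' Hx Hx'|a b].
- by rewrite !tmul0l.
- by rewrite !tmulDl Hx Hx'.
elim/tensor_ind: y => [|y y' Hy Hy'|c d].
- by rewrite !(tmul0l, tmul0r).
- by rewrite !(tmulDl, tmulDr) Hy Hy'.
elim/tensor_ind: z => [|z z' Hz Hz'|e f].
- by rewrite !tmul0r.
- by rewrite !tmulDr Hz Hz'.
by rewrite !tmul_tens !numulA.
Qed.

HB.instance Definition _ :=
  isNuAlg.Build K (tensor A B) tmulA tmulDl tmulDr tmulZl tmulZr.

Lemma numul_tens (a c : A) (b d : B) :
  (a \ox b) ** (c \ox d) = (a ** c) \ox (b ** d).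
Proof. exact: tmul_tens. Qed.

End TensorAlg.

(* [V] with scalars acting through complex conjugation *)
Definition conjmod (K : numClosedFieldType) (V : lmodType K) : Type := V.

Section ConjMod.
Variables (K : numClosedFieldType) (V : lmodType K).
HB.instance Definition _ := GRing.Zmodule.on (conjmod V).

Definition cscale (k : K) (v : conjmod V) : conjmod V := k^* *: (v : V).
Let cscaleA a b v : cscale a (cscale b v) = cscale (a * b) v.
Proof. by rewrite /cscale scalerA rmorphM. Qed.
Let cscale1 : left_id 1 cscale.
Proof. by move=> v; rewrite /cscale rmorph1 scale1r. Qed.
Let cscaleDr : right_distributive cscale +%R.
Proof. by move=> k u v; rewrite /cscale scalerDr. Qed.
Let cscaleDl v : {morph cscale^~ v : a b / a + b}.
Proof. by move=> a b; rewrite /cscale rmorphD scalerDl. Qed.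
HB.instance Definition _ :=
  GRing.Zmodule_isLmodule.Build K (conjmod V) cscaleA cscale1 cscaleDr cscaleDl.
End ConjMod.

Section TensorStar.
Variables (K : numClosedFieldType) (A B : starAlgType K).

Definition tstar : tensor A B -> tensor A B :=
  tlift (fun a b => star a \ox star b).

Let cbil : bilinear_for *:%R *:%R
  (fun (a : A) (b : B) => (star a \ox star b : conjmod (tensor A B))).
Proof.
have [bl br] := @tens_bilinear K A B.
split=> c k u v; rewrite starD starZ.
- exact: bl.
- exact: br.
Qed.

Lemma tstar_tens a b : tstar (a \ox b) = star a \ox star b.
Proof. exact: (tlift_tens a b cbil). Qed.

Let tstarD : {morph tstar : x y / x + y}.
Proof. by move=> x y; exact: (tlift_add x y cbil). Qed.
Let tstarZ k x : tstar (k *: x) = k^* *: tstar x.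
Proof. exact: (tlift_scale k x cbil). Qed.
Let tstar0 : tstar 0 = 0.
Proof. by rewrite -[X in tstar X](scale0r 0) tstarZ rmorph0 scale0r. Qed.
Let tstarK : involutive tstar.
Proof.
elim/tensor_ind=> [|x y Hx Hy|a b]; first by rewrite !tstar0.
- by rewrite !tstarD Hx Hy.
- by rewrite !tstar_tens !starK.
Qed.
Let tstarM x y : tstar (x ** y) = tstar y ** tstar x.
Proof.
elim/tensor_ind: x => [|x x' Hx Hx'|a b].
- by rewrite numul0l !tstar0 numul0r.
- by rewrite numulDl !tstarD Hx Hx' numulDr.
elim/tensor_ind: y => [|y y' Hy Hy'|c d].
- by rewrite numul0r !tstar0 numul0l.
- by rewrite numulDr !tstarD Hy Hy' numulDl.
by rewrite numul_tens !tstar_tens numul_tens !starM.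
Qed.

HB.instance Definition _ :=
  NuAlg_isStar.Build K (tensor A B) tstarK tstarD tstarZ tstarM.

End TensorStar.

Section Multiplier.
Variables (K : fieldType) (A : nuAlgType K).

(* A multiplier m is the pair of maps b |-> m b and b |-> b m. *)
Definition is_mult (p : (A -> A) * (A -> A)) : Prop :=
  [/\ linear p.1, linear p.2,
      forall a b, p.1 (a ** b) = p.1 a ** b,
      forall a b, p.2 (a ** b) = a ** p.2 b &
      forall a b, p.2 a ** b = a ** p.1 b].

Definition multb : pred ((A -> A) * (A -> A)) := fun p => `[< is_mult p >].

Record mult := Mult { mult_val : (A -> A) * (A -> A); _ : multb mult_val }.
HB.instance Definition _ := [isSub for mult_val].
HB.instance Definition _ := [Choice of mult by <:].

Definition lact (m : mult) : A -> A := (mult_val m).1.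
Definition ract (m : mult) : A -> A := (mult_val m).2.

Lemma multP (m : mult) : is_mult (lact m, ract m).
Proof. by case: m => -[l r] Hm; have /asboolP := Hm. Qed.

Lemma mult_ext (m n : mult) : lact m =1 lact n -> ract m =1 ract n -> m = n.
Proof.
move=> /funext El /funext Er; apply: val_inj.
by move: El Er; rewrite /lact /ract /=; case: (mult_val m) (mult_val n) =>
  [? ?] [? ?] /= -> ->.
Qed.

Lemma multb_submod : submod_closed multb.
Proof.
split.
  apply/asboolP; split=> [k a b|k a b|a b|a b|a b] /=.
  - by rewrite [RHS]addr0 [RHS]scaler0.
  - by rewrite [RHS]addr0 [RHS]scaler0.
  - by rewrite numul0l.
  - by rewrite numul0r.
  - by rewrite numul0l numul0r.
move=> k [l r] [l' r'] /asboolP[ll lr lM rM lrM] /asboolP[ll' lr' lM' rM' lrM'].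
rewrite /= in ll lr lM rM lrM ll' lr' lM' rM' lrM'.
have E (f g : A -> A) x : (k *: f + g) x = k *: f x + g x by [].
apply/asboolP; split=> [c a b|c a b|a b|a b|a b] /=; rewrite !E.
- by rewrite ll ll' !scalerDr !scalerA [c * k]mulrC addrACA.
- by rewrite lr lr' !scalerDr !scalerA [c * k]mulrC addrACA.
- by rewrite lM lM' numulDl numulZl.
- by rewrite rM rM' numulDr numulZr.
- by rewrite numulDl numulZl numulDr numulZr lrM lrM'.
Qed.

HB.instance Definition _ :=
  GRing.isSubmodClosed.Build K ((A -> A) * (A -> A))%type multb multb_submod.
HB.instance Definition _ := [SubChoice_isSubLmodule of mult by <:].

Lemma one_mult_subproof : multb (id, id).
Proof. by apply/asboolP; split. Qed.
Definition one_mult : mult := Mult one_mult_subproof.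

Lemma mul_mult_subproof (m n : mult) :
  multb (lact m \o lact n, ract n \o ract m).
Proof.
have [ll lr lM rM lrM] := multP m; have [ll' lr' lM' rM' lrM'] := multP n.
rewrite /= in ll lr lM rM lrM ll' lr' lM' rM' lrM'.
apply/asboolP; split=> [c a b|c a b|a b|a b|a b] /=.
- by rewrite ll' ll.
- by rewrite lr lr'.
- by rewrite lM' lM.
- by rewrite rM rM'.
- by rewrite lrM' lrM.
Qed.
Definition mul_mult (m n : mult) : mult := Mult (mul_mult_subproof m n).

Lemma lact_is_linear (m : mult) : linear (lact m).
Proof. by have [] := multP m. Qed.
Lemma ract_is_linear (m : mult) : linear (ract m).
Proof. by have [] := multP m. Qed.

Let mul_multA : associative mul_mult.
Proof. by move=> m n p; apply: mult_ext. Qed.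
Let mul_mult1l : left_id one_mult mul_mult.
Proof. by move=> m; apply: mult_ext. Qed.
Let mul_mult1r : right_id one_mult mul_mult.
Proof. by move=> m; apply: mult_ext. Qed.
Let linD (f : A -> A) : linear f -> {morph f : x y / x + y}.
Proof. by move=> lf x y; have := lf 1 x y; rewrite !scale1r. Qed.
Let mul_multDl : left_distributive mul_mult +%R.
Proof.
move=> m n p; apply: mult_ext => a //=.
exact: (linD (ract_is_linear p)).
Qed.
Let mul_multDr : right_distributive mul_mult +%R.
Proof.
move=> m n p; apply: mult_ext => a //=.
exact: (linD (lact_is_linear m)).
Qed.
HB.instance Definition _ := GRing.Zmodule_isPzRing.Build mult
  mul_multA mul_mult1l mul_mult1r mul_multDl mul_multDr.

Lemma to_mult_subproof (a : A) : multb (numul a, numul^~ a).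
Proof.
apply/asboolP; split=> [k b c|k b c|b c|b c|b c] /=.
- by rewrite numulDr numulZr.
- by rewrite numulDl numulZl.
- by rewrite numulA.
- by rewrite numulA.
- by rewrite numulA.
Qed.

(* the canonical map from A to M(A), an embedding when A is nondegenerate *)
Definition to_mult (a : A) : mult := Mult (to_mult_subproof a).

Definition in_alg (m : mult) : Prop := exists x : A, to_mult x = m.

(* The element of A that m is the image of; it is 0 when there is none. *)
Definition of_mult (m : mult) : A := xget 0 [set x | to_mult x = m].

End Multiplier.

Section MultTensor.
Variables (K : fieldType) (A B : nuAlgType K).

Lemma tens_mult_subproof (m : mult A) (n : mult B) :
  multb (tmap (lact m) (lact n), tmap (ract m) (ract n)).
Proof.
have [ll lr lM rM lrM] := multP m; have [ll' lr' lM' rM' lrM'] := multP n.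
rewrite /= in ll lr lM rM lrM ll' lr' lM' rM' lrM'.
have lL := tmap_is_linear ll ll'; have lR := tmap_is_linear lr lr'.
have z (V W : lmodType K) (f : V -> W) : linear f -> f 0 = 0.
  by move=> lf; have := lf (-1) 0 0; rewrite scaler0 addr0 scaleN1r addNr.
have D (V W : lmodType K) (f : V -> W) : linear f -> {morph f : x y / x + y}.
  by move=> lf x y; have := lf 1 x y; rewrite !scale1r.
have [zL zR DL DR] := And4 (z _ _ _ lL) (z _ _ _ lR) (D _ _ _ lL) (D _ _ _ lR).
apply/asboolP; split=> //= x y.
- elim/tensor_ind: x => [|x x' Hx Hx'|a b].
  + by rewrite !(numul0l, zL).
  + by rewrite !(numulDl, DL) Hx Hx'.
  elim/tensor_ind: y => [|y y' Hy Hy'|c d].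
  + by rewrite !(numul0r, zL).
  + by rewrite !(numulDr, DL) -Hy -Hy'.
  by rewrite numul_tens !tmap_tens// numul_tens lM lM'.
- elim/tensor_ind: x => [|x x' Hx Hx'|a b].
  + by rewrite !(numul0l, zR).
  + by rewrite !(numulDl, DR) Hx Hx'.
  elim/tensor_ind: y => [|y y' Hy Hy'|c d].
  + by rewrite !(numul0r, zR, numul0r).
  + by rewrite !(numulDr, DR) Hy Hy'.
  by rewrite numul_tens !tmap_tens// numul_tens rM rM'.
- elim/tensor_ind: x => [|x x' Hx Hx'|a b].
  + by rewrite zR !numul0l.
  + by rewrite DR !numulDl Hx Hx'.
  elim/tensor_ind: y => [|y y' Hy Hy'|c d].
  + by rewrite zL !numul0r.
  + by rewrite DL !numulDr Hy Hy'.
  by rewrite !tmap_tens// !numul_tens lrM lrM'.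
Qed.
Definition tens_mult (m : mult A) (n : mult B) : mult (tensor A B) :=
  Mult (tens_mult_subproof m n).

End MultTensor.

Notation "m \oxm n" := (tens_mult m n) : ring_scope.

Section MultStar.
Variables (K : numClosedFieldType) (A : starAlgType K).

Lemma mult_star_subproof (m : mult A) :
  multb (star \o ract m \o star, star \o lact m \o star).
Proof.
have [ll lr lM rM lrM] := multP m; rewrite /= in ll lr lM rM lrM.
apply/asboolP; split=> [k a b|k a b|a b|a b|a b] /=.
- by rewrite starD starZ lr starD starZ conjCK.
- by rewrite starD starZ ll starD starZ conjCK.
- by rewrite starM rM starM starK.
- by rewrite starM lM starM starK.
- by rewrite -[b in LHS]starK -starM -lrM starM starK.
Qed.
Definition mult_star (m : mult A) : mult A := Mult (mult_star_subproof m).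

End MultStar.

Section Coproduct.
Variables (K : fieldType) (A : nuAlgType K) (Delta : A -> mult (tensor A A)).

(* a (x) 1 and 1 (x) a *)
Definition ml (a : A) : mult (tensor A A) := to_mult a \oxm 1.
Definition mr (a : A) : mult (tensor A A) := 1 \oxm to_mult a.

(* Equality of two multipliers of the threefold tensor product, up to the
   associativity isomorphism. *)
Definition mult_assoc_eq (m : mult (tensor (tensor A A) A))
    (n : mult (tensor A (tensor A A))) : Prop :=
  forall x, @tassoc K A A A (lact m x) = lact n (tassoc x) /\
            @tassoc K A A A (ract m x) = ract n (tassoc x).

(* Delta (x) iota and iota (x) Delta on A (x) A *)
Definition Delta_l : tensor A A -> mult (tensor (tensor A A) A) :=
  tlift (fun a b => Delta a \oxm to_mult b).
Definition Delta_r : tensor A A -> mult (tensor A (tensor A A)) :=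
  tlift (fun a b => to_mult a \oxm Delta b).

(* To be used when Delta(a) (1 (x) b) and (c (x) 1) Delta(a) are in A (x) A, so
   that [of_mult] returns them as elements of A (x) A. *)
Definition coassociative : Prop := forall a b c : A,
  mult_assoc_eq
    (((to_mult c \oxm 1) \oxm 1) * Delta_l (of_mult (Delta a * mr b)))
    (Delta_r (of_mult (ml c * Delta a)) * (1 \oxm (1 \oxm to_mult b))).

(* (w (x) iota) m = n and (iota (x) w) m = n in M(A), for m in M(A (x) A) such
   that m (1 (x) b), (1 (x) b) m, resp. m (b (x) 1), (b (x) 1) m, are in
   A (x) A. *)
Definition lslice_mult (w : A -> K) (m : mult (tensor A A)) (n : mult A) : Prop :=
  forall b : A, lslice w (of_mult (m * mr b)) = lact n b /\
                lslice w (of_mult (mr b * m)) = ract n b.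
Definition rslice_mult (w : A -> K) (m : mult (tensor A A)) (n : mult A) : Prop :=
  forall b : A, rslice w (of_mult (m * ml b)) = lact n b /\
                rslice w (of_mult (ml b * m)) = ract n b.

Definition is_counit (eps : {scalar A}) : Prop :=
  (forall a b, eps (a ** b) = eps a * eps b) /\
  (forall a, lslice_mult eps (Delta a) (to_mult a) /\
             rslice_mult eps (Delta a) (to_mult a)).

Definition left_invariant (phi : {scalar A}) : Prop :=
  forall a, rslice_mult phi (Delta a) (phi a *: (1 : mult A)).

End Coproduct.

Section AlgebraicQuantumGroup.
Variables (K : numClosedFieldType) (A : starAlgType K).
Variable Delta : {linear A -> mult (tensor A A)}.

Record multiplier_Hopf_star : Prop := {
  mhs_nondegenerate : nondegenerate A;
  mhs_mul : forall a b, Delta (a ** b) = Delta a * Delta b;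
  mhs_star : forall a, Delta (star a) = mult_star (Delta a);
  mhs_Delta_nondegenerate : forall x : tensor A A,
    (exists s : seq (A * tensor A A), x = \sum_(p <- s) lact (Delta p.1) p.2) /\
    (exists s : seq (A * tensor A A), x = \sum_(p <- s) ract (Delta p.1) p.2);
  mhs_T1 : exists2 T : {linear tensor A A -> tensor A A}, bijective T &
    forall a b, to_mult (T (a \ox b)) = Delta a * mr b;
  mhs_T2 : exists2 T : {linear tensor A A -> tensor A A}, bijective T &
    forall a b, to_mult (T (a \ox b)) = ml a * Delta b;
  mhs_coassociative : coassociative Delta
}.

(* m (S (x) iota) (Delta(a) (1 (x) b)) = eps(a) b and
   m (iota (x) S) ((a (x) 1) Delta(b)) = eps(b) a, m being the product. *)
Definition is_antipode (eps : {scalar A}) (S : {linear A -> A}) : Prop :=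
  (forall a b, S (a ** b) = S b ** S a) /\
  (forall a b,
     tlift (fun x y => S x ** y) (of_mult (Delta a * mr b)) = eps a *: b /\
     tlift (fun x y => x ** S y) (of_mult (ml a * Delta b)) = eps b *: a).

Definition positive_left_integral (phi : {scalar A}) : Prop :=
  [/\ exists a, phi a != 0, forall a, 0 <= phi (star a ** a) &
      left_invariant Delta phi].

Definition group_like_projection (h : A) : Prop :=
  [/\ h != 0, h ** h = h, star h = h & Delta h * mr h = to_mult (h \ox h)].

(* The existence of s says that Delta(h) (a (x) 1) is in A (x) V. *)
Definition contains_right_leg (h : A) (V : {pred A}) : Prop :=
  forall a : A, exists2 s : seq (A * A),
    all (fun p => p.2 \in V) s &
    to_mult (\sum_(p <- s) p.1 \ox p.2) = Delta h * ml a.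

Definition is_right_leg (h : A) (C : {pred A}) : Prop :=
  [/\ submod_closed C, contains_right_leg h C &
      forall V : {pred A}, submod_closed V -> contains_right_leg h V ->
        {subset C <= V}].

Definition C1 (S : A -> A) (C : {pred A}) : {pred A} :=
  [pred a | (a \in C) && `[< exists2 c, c \in C & a = S c >]].

Definition cond_exp (phi : {scalar A}) (h a : A) : A :=
  rslice phi (of_mult (Delta a * mr h)).

End AlgebraicQuantumGroup.

Record subalgebra (K : fieldType) (A : nuAlgType K) := Subalgebra {
  sub_pred :> pred A;
  sub_submod : submod_closed sub_pred;
  sub_mul : forall a b, sub_pred a -> sub_pred b -> sub_pred (a ** b)
}.

Section SubalgebraType.
Variables (K : fieldType) (A : nuAlgType K) (D : subalgebra A).

HB.instance Definition _ :=
  GRing.isSubmodClosed.Build K A (sub_pred D) (sub_submod D).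

Record sub_alg := SubAlg { sub_val :> A; _ : sub_pred D sub_val }.
HB.instance Definition _ := [isSub for sub_val].
HB.instance Definition _ := [Choice of sub_alg by <:].
HB.instance Definition _ := [SubChoice_isSubLmodule of sub_alg by <:].

Definition sub_alg_mul (a b : sub_alg) : sub_alg :=
  SubAlg (sub_mul (valP a) (valP b)).

Let smulA : associative sub_alg_mul.
Proof. by move=> a b c; apply: val_inj; rewrite /= numulA. Qed.
Let smulDl : left_distributive sub_alg_mul +%R.
Proof. by move=> a b c; apply: val_inj; rewrite /= numulDl. Qed.
Let smulDr : right_distributive sub_alg_mul +%R.
Proof. by move=> a b c; apply: val_inj; rewrite /= numulDr. Qed.
Let smulZl k a b : sub_alg_mul (k *: a) b = k *: sub_alg_mul a b.
Proof. by apply: val_inj; rewrite /= numulZl. Qed.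
Let smulZr k a b : sub_alg_mul a (k *: b) = k *: sub_alg_mul a b.
Proof. by apply: val_inj; rewrite /= numulZr. Qed.
HB.instance Definition _ :=
  isNuAlg.Build K sub_alg smulA smulDl smulDr smulZl smulZr.

End SubalgebraType.

(* Delta1(a) (1 (x) b) = (E (x) iota) (Delta(a) (1 (x) b)) and
   (1 (x) b) Delta1(a) = (E (x) iota) ((1 (x) b) Delta(a)) for a, b in D,
   the left-hand sides being in D (x) D, included in A (x) A. *)
Definition is_compressed_coproduct (K : fieldType) (A : nuAlgType K)
    (Delta : A -> mult (tensor A A)) (E : A -> A) (D : subalgebra A)
    (Delta1 : sub_alg D -> mult (tensor (sub_alg D) (sub_alg D))) : Prop :=
  forall a b : sub_alg D,
    (exists2 x : tensor (sub_alg D) (sub_alg D), to_mult x = Delta1 a * mr b &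
       tmap (@sub_val K A D) (@sub_val K A D) x =
       tmap E id (of_mult (Delta (sub_val a) * mr (sub_val b)))) /\
    (exists2 x : tensor (sub_alg D) (sub_alg D), to_mult x = mr b * Delta1 a &
       tmap (@sub_val K A D) (@sub_val K A D) x =
       tmap E id (of_mult (mr (sub_val b) * Delta (sub_val a)))).

Section AlgebraicQuantumHypergroup.
Variables (K : fieldType) (D : nuAlgType K).
Variable Delta : {linear D -> mult (tensor D D)}.

Definition faithful (phi : {scalar D}) : Prop := forall b : D,
  ((forall a, phi (a ** b) = 0) -> b = 0) /\
  ((forall a, phi (b ** a) = 0) -> b = 0).

Definition is_antipode_relative (phi : {scalar D}) (S : {linear D -> D}) : Prop :=
  [/\ bijective S, forall a b, S (a ** b) = S b ** S a &
      forall a b, S (rslice phi (of_mult (Delta a * mr b))) =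
                  rslice phi (of_mult (mr a * Delta b))].

Record algebraic_quantum_hypergroup : Prop := {
  aqh_nondegenerate : nondegenerate D;
  aqh_range : forall a b,
    [/\ in_alg (Delta a * mr b), in_alg (ml a * Delta b),
        in_alg (Delta a * ml b) & in_alg (mr a * Delta b)];
  aqh_coassociative : coassociative Delta;
  aqh_counit : exists eps : {scalar D}, is_counit Delta eps;
  aqh_integral_antipode : exists2 phi : {scalar D},
    left_invariant Delta phi /\ faithful phi &
    exists S : {linear D -> D}, is_antipode_relative phi S
}.

Definition discrete_type : Prop :=
  exists2 eps : {scalar D}, is_counit Delta eps &
    exists2 k : D, k != 0 & forall a, a ** k = eps a *: k.

End AlgebraicQuantumHypergroup.

(* Main.v *)
(* Instead of multipliers of A (x) A one works with the operators
   L_w = (w (x) iota) Delta and R_w = (iota (x) w) Delta of A into itself, for w of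
   the form f(b .) or f(. b).  These functionals separate points, every L_w commutes
   with every R_u by coassociativity, and w R_u = u L_w; an identity between tensors
   is checked by slicing it with such functionals.

   Strong left invariance of phi gives the bijectivity of S, the faithfulness of phi
   and the anticomultiplicativity of S.  Integrating Delta(h)(1 (x) h) = h (x) h shows
   that S h = h and that phi(h .) = phi(. h) =: w is invariant under S.  Then E = R_w
   and E' = L_w are commuting idempotents exchanged by S, C is the range of E, and
   C1 is the range of E E', a bimodule projection onto C1.  So Delta1 is Delta
   followed by compression by E E' (x) E E', and, as the compressed Delta(E x) and
   Delta(E' x) equal the compressed Delta(x), coassociativity, counit, integral and
   antipode descend from A to C1.  The co-integral is h. *)
From HB Require Import structures.
From mathcomp Require Import all_boot all_order all_algebra.
From mathcomp Require Import boolp classical_sets.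
From mathcomp Require Import complex reals ring.
Require Import Defs.

Set Implicit Arguments.
Unset Strict Implicit.
Unset Printing Implicit Defensive.

Import Order.TTheory GRing.Theory Num.Theory.
Local Open Scope classical_set_scope.
Local Open Scope ring_scope.

(** * Linear functionals and tensors *)

(** [Delta1] need not be multiplicative, so its axioms are not proved by computing with [Delta1] but
    read off from [Delta]. The definition puts [E] in one leg only, while compressing an element of
    A (x) A to C1 (x) C1 takes E E' in both legs. For arguments in C1 the two agree, because three
    of the four idempotents are absorbed, thanks to (E (x) iota) Delta = (iota (x) E') Delta. Moving
    the projection to the other leg in this way also lets the counit act on [Delta] itself. E(a c) =
    E(a) c comes from the functional phi(. h), and E(c a) = c E(a) from phi(h .), so these
    functionals must be known to be equal before C1 can be handled. [E'] is built here from phi(. h)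
    too: for psi = phi S one has psi(a h) = phi(h S(a)) = phi(a h), so this is the [E'] of the right
    integral psi. Positivity enters through the faithfulness of phi, which passes to C1 because C1
    is closed under the involution. *)

Fact mk_linear_subproof (K : fieldType) (U V : lmodType K) (f : U -> V) :
  linear f -> {g : {linear U -> V} | g =1 f}.
Proof.
by move=> lf; pose g : {linear U -> V} :=
  HB.pack f (GRing.isLinear.Build K U V *:%R f lf); exists g.
Qed.
(* opaque, so that simplification does not unfold the map *)
Definition mk_linear (K : fieldType) (U V : lmodType K) (f : U -> V)
  (lf : linear f) : {linear U -> V} := sval (mk_linear_subproof lf).
Lemma mk_linearE (K : fieldType) (U V : lmodType K) (f : U -> V)
  (lf : linear f) x : mk_linear lf x = f x.
Proof. exact: (svalP (mk_linear_subproof lf)). Qed.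

Fact mk_scalar_subproof (K : fieldType) (U : lmodType K) (f : U -> K) :
  scalar f -> {g : {scalar U} | g =1 f}.
Proof.
by move=> lf; pose g : {scalar U} :=
  HB.pack f (GRing.isLinear.Build K U K *%R f lf); exists g.
Qed.
Definition mk_scalar (K : fieldType) (U : lmodType K) (f : U -> K)
  (lf : scalar f) : {scalar U} := sval (mk_scalar_subproof lf).
Lemma mk_scalarE (K : fieldType) (U : lmodType K) (f : U -> K)
  (lf : scalar f) x : mk_scalar lf x = f x.
Proof. exact: (svalP (mk_scalar_subproof lf)). Qed.

Section Functionals.
Variables (K : fieldType) (V : lmodType K).

(** A subspace maximal among those avoiding [v] is a complement of the line of [v]; the functional
    is the coordinate along [v]. *)
Lemma exists_functional (v : V) : v != 0 -> exists f : {scalar V}, f v != 0.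
Proof.
move=> v0; pose P (W : set V) :=
  (forall (k : K) u w, W u -> W w -> W (k *: u + w)) /\ ~ W v.
have [F FP Ftot|W [[Wlin Wv] Wmax]] := @Zorn_bigcup V P.
  split=> [k u w [X FX Xu] [Y FY Yw]|[X FX Xv]]; last by have [_] := FP _ FX.
  by have [XY|YX] := Ftot _ _ FX FY;
    [exists Y => //; have [+ _] := FP _ FY|exists X => //; have [+ _] := FP _ FX];
    apply => //; [exact: XY|exact: YX].
(* The empty set satisfies [P], as the union of the empty chain must, so it takes maximality to see
   that [W] contains 0. *)
have W0 : W 0.
  apply: contrapT => nW0.
  have nW u : ~ W u.
    by move=> Wu; apply: nW0; rewrite -(addNr u) -scaleN1r; apply: Wlin.
  apply: (Wmax [set 0]); first by split=> [u /nW//|/(_ 0 erefl)].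
  by split=> [k u w /= -> ->|/= /eqP]; [rewrite scaler0 addr0|apply/negP].
have Wsub k u : W u -> W (k *: u).
  by move=> Wu; rewrite -[X in W X]addr0; apply: Wlin.
have WD u u' : W u -> W u' -> W (u + u').
  by move=> Wu Wu'; rewrite -[u]scale1r; apply: Wlin.
(* Otherwise [W] + K u would still avoid [v], against maximality. *)
have decomp u : exists k, W (u - k *: v).
  apply: contrapT => nk; have Wu : ~ W u.
    by move=> Wu; apply: nk; exists 0; rewrite scale0r subr0.
  pose W' : set V := fun x => exists2 w, W w & exists k, x = w + k *: u.
  apply: (Wmax W').
    split=> [x Wx|sub]; first by exists x => //; exists 0; rewrite scale0r addr0.
    by apply/Wu/sub; exists 0 => //; exists 1; rewrite scale1r add0r.
  split.
    move=> k x y [w Ww [a ->]] [w' Ww' [a' ->]].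
    exists (k *: w + w'); first exact: Wlin.
    exists (k * a + a'); rewrite scalerDr scalerA scalerDl.
    by rewrite addrACA.
  move=> [w Ww [k vE]]; have k0 : k != 0.
    by apply/eqP => k0; apply: Wv; rewrite vE k0 scale0r addr0.
  apply: nk; exists k^-1; rewrite vE scalerDr scalerA mulVf// scale1r.
  by rewrite opprD addrCA subrr addr0 -scaleNr; apply: Wsub.
pose f u := projT1 (cid (decomp u)).
have fP u : W (u - f u *: v) by rewrite /f; case: cid.
have funi u k : W (u - k *: v) -> f u = k.
  move=> Wk; apply/eqP; apply: contrapT => /negP fk; apply: Wv.
  have fk0 : f u - k != 0 by rewrite subr_eq0.
  rewrite -[v]scale1r -(mulVf fk0) -scalerA; apply: (Wsub).
  rewrite (_ : _ *: v = (u - k *: v) + (-1) *: (u - f u *: v)).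
    by apply: WD => //; apply: Wsub.
  by rewrite scaleN1r opprB [RHS]addrC addrA subrK scalerBl.
have lf : scalar f.
  move=> k u w; apply: funi; rewrite scalerDl -scalerA opprD addrACA.
  by rewrite -scalerBr; apply: Wlin.
by exists (mk_scalar lf); rewrite mk_scalarE (funi v 1) ?oner_eq0// scale1r subrr.
Qed.

End Functionals.

Lemma functional_eq (K : fieldType) (V : lmodType K) (u v : V) :
  (forall f : {scalar V}, f u = f v) -> u = v.
Proof.
move=> uv; apply/eqP; apply: contrapT => /negP; rewrite -subr_eq0.
by move=> /exists_functional[f]; rewrite linearB /= uv subrr eqxx.
Qed.

HB.instance Definition _ (K : fieldType) (A : nuAlgType K) (m : mult A) :=
  GRing.isLinear.Build K A A *:%R (lact m) (lact_is_linear m).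
HB.instance Definition _ (K : fieldType) (A : nuAlgType K) (m : mult A) :=
  GRing.isLinear.Build K A A *:%R (ract m) (ract_is_linear m).
HB.instance Definition _ (K : fieldType) (A B A' B' : lmodType K)
    (f : {linear A -> A'}) (g : {linear B -> B'}) :=
  GRing.isLinear.Build K (tensor A B) (tensor A' B') *:%R (tmap f g)
    (tmap_is_linear (linearP f) (linearP g)).

Section Tensors.
Variables (K : fieldType) (A B : lmodType K).

Lemma lslice_bilinear (w : {scalar A}) :
  bilinear_for *:%R *:%R (fun (a : A) (b : B) => w a *: b).
Proof.
split=> c k u v /=; first by rewrite linearP scalerDl -scalerA.
by rewrite scalerDr !scalerA mulrC.
Qed.

Lemma rslice_bilinear (w : {scalar B}) :
  bilinear_for *:%R *:%R (fun (a : A) (b : B) => w b *: a).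
Proof.
split=> c k u v /=; last by rewrite linearP scalerDl -scalerA.
by rewrite scalerDr !scalerA mulrC.
Qed.

HB.instance Definition _ (w : {scalar A}) :=
  GRing.isLinear.Build K (tensor A B) B *:%R (lslice w)
    (tlift_is_linear (lslice_bilinear w)).
HB.instance Definition _ (w : {scalar B}) :=
  GRing.isLinear.Build K (tensor A B) A *:%R (rslice w)
    (tlift_is_linear (rslice_bilinear w)).

Lemma lslice_tens (w : {scalar A}) a b : @lslice K A B w (a \ox b) = w a *: b.
Proof. by rewrite /lslice tlift_tens//; apply: lslice_bilinear. Qed.
Lemma rslice_tens (w : {scalar B}) a b : @rslice K A B w (a \ox b) = w b *: a.
Proof. by rewrite /rslice tlift_tens//; apply: rslice_bilinear. Qed.

Lemma tensDl (a a' : A) (b : B) : (a + a') \ox b = a \ox b + a' \ox b.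
Proof. by have := (tens_bilinear A B).1 b 1 a a'; rewrite /= !scale1r. Qed.
Lemma tensDr (a : A) (b b' : B) : a \ox (b + b') = a \ox b + a \ox b'.
Proof. by have := (tens_bilinear A B).2 a 1 b b'; rewrite /= !scale1r. Qed.
Lemma tens0l (b : B) : (0 : A) \ox b = 0.
Proof. by have := tensDl 0 0 b; rewrite addr0 -[LHS]addr0 => /addrI. Qed.
Lemma tens0r (a : A) : a \ox (0 : B) = 0.
Proof. by have := tensDr a 0 0; rewrite addr0 -[LHS]addr0 => /addrI. Qed.
Lemma tensZl k (a : A) (b : B) : (k *: a) \ox b = k *: (a \ox b).
Proof. by have := (tens_bilinear A B).1 b k a 0; rewrite /= tens0l !addr0. Qed.
Lemma tensZr k (a : A) (b : B) : a \ox (k *: b) = k *: (a \ox b).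
Proof. by have := (tens_bilinear A B).2 a k b 0; rewrite /= tens0r !addr0. Qed.

Lemma tmap_tensE (A' B' : lmodType K) (f : {linear A -> A'}) (g : {linear B -> B'})
  a b : tmap f g (a \ox b) = f a \ox g b.
Proof. by rewrite tmap_tens//; apply: linearP. Qed.

Lemma tensor_eq (V : lmodType K) (f g : {linear tensor A B -> V}) :
  (forall a b, f (a \ox b) = g (a \ox b)) -> f =1 g.
Proof. by apply: tensor_ext; apply: linearP. Qed.

Lemma tlift_sum (V : lmodType K) (f : A -> B -> V) (s : seq (A * B)) :
  bilinear_for *:%R *:%R f ->
  tlift f (\sum_(p <- s) p.1 \ox p.2) = \sum_(p <- s) f p.1 p.2.
Proof.
move=> bf; rewrite -[LHS](mk_linearE (tlift_is_linear bf)) linear_sum.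
by apply: eq_bigr => p _; rewrite mk_linearE tlift_tens.
Qed.

Definition separating (W : {scalar A} -> Prop) :=
  forall a : A, (forall w, W w -> w a = 0) -> a = 0.

Lemma separatingT : separating (fun _ => True).
Proof.
move=> a wa; apply/eqP; apply: contrapT => /negP/exists_functional[f].
by rewrite wa// eqxx.
Qed.

(* By induction on the length of a representation of x: if w p != 0 for the
   first term p (x) q then q is, up to V, a combination of the other second legs,
   which shortens the representation. *)
Lemma tensor_rleg (W : {scalar A} -> Prop) (V : {pred B}) (x : tensor A B) :
  separating W -> submod_closed V ->
  (forall w, W w -> lslice w x \in V) ->
  exists2 s : seq (A * B), all (fun p => p.2 \in V) s &
    x = \sum_(p <- s) p.1 \ox p.2.
Proof.
move=> sepW [V0 Vlin]; rewrite (tensor_sum x).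
move: (repr x : seq _) => t; move: {2}(size t) (leqnn (size t)) => n.
elim: n t => [|n IHn] [|[p q] t]//= => [_ _|_ _|]; rewrite ?big_nil;
  try by exists [::]; rewrite ?big_nil.
rewrite ltnS => tn Vt.
have [p0|/eqP p0] := pselect (p = 0).
  move: Vt; rewrite big_cons /= p0 tens0l add0r => Vt; exact: IHn.
have [w Ww wp] : exists2 w, W w & w p != 0.
  apply: contrapT => H; apply/negP: p0; rewrite negbK; apply/eqP/sepW => w Ww.
  by apply/eqP/negP => /negP wp; apply: H; exists w.
have := Vt w Ww; rewrite big_cons linearD /= lslice_tens.
set z := lslice w _ => Vz.
pose t' := [seq (r.1 - ((w p)^-1 * w r.1) *: p, r.2) | r <- t].
pose v := (w p)^-1 *: (w p *: q + z).
have Vv : v \in V by rewrite /v -[_ *: _]addr0; apply: Vlin.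
have sumE : \sum_(r <- (p, q) :: t) r.1 \ox r.2 =
    p \ox v + \sum_(r <- t') r.1 \ox r.2.
  rewrite big_cons big_map /v scalerDr scalerA mulVf// scale1r tensDr -addrA /=.
  congr (_ + _); rewrite tensZr /z linear_sum (big_morph _ (tensDr p) (tens0r p)).
  rewrite scaler_sumr -big_split /=.
  apply: eq_bigr => r _; rewrite lslice_tens tensZr tensDl -scaleNr tensZl.
  by rewrite scalerA addrC -addrA -scalerDl addNr scale0r addr0.
have [||s sV sE] := IHn t'; first by rewrite size_map.
  move=> w' Ww'; have := Vt w' Ww'; rewrite sumE linearD /= lslice_tens => Vs.
  have := Vlin (- w' p) _ _ Vv Vs.
  by rewrite scaleNr addrA addNr add0r.
by exists ((p, v) :: s); [rewrite /= Vv|rewrite [RHS]big_cons -sE -sumE big_cons].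
Qed.

Lemma tensor_lslice0 (W : {scalar A} -> Prop) (x : tensor A B) :
  separating W -> (forall w, W w -> lslice w x = 0) -> x = 0.
Proof.
move=> sepW x0; have [||s /allP s0 ->] := @tensor_rleg W (pred1 0) x sepW.
- split; rewrite ?inE// => k u v; rewrite !inE => /eqP-> /eqP->.
  by rewrite scaler0 addr0.
- by move=> w /x0; rewrite inE => ->.
rewrite big_seq big1// => p /s0; rewrite inE => /eqP->; exact: tens0r.
Qed.

End Tensors.

Section Swap.
Variables (K : fieldType) (A B : lmodType K).

Lemma swap_bilinear : bilinear_for *:%R *:%R (fun (a : A) (b : B) => b \ox a).
Proof. by split=> c k u v; [apply: (tens_bilinear B A).2|apply: (tens_bilinear B A).1]. Qed.

Definition tswap : tensor A B -> tensor B A := tlift (fun a b => b \ox a).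
HB.instance Definition _ :=
  GRing.isLinear.Build K (tensor A B) (tensor B A) *:%R tswap
    (tlift_is_linear swap_bilinear).

Lemma tswap_tens a b : tswap (a \ox b) = b \ox a.
Proof. exact: tlift_tens swap_bilinear. Qed.

Lemma lslice_tswap (w : {scalar B}) x : lslice w (tswap x) = rslice w x.
Proof.
by apply: (tensor_eq (f := lslice w \o tswap) (g := rslice w)) => a b;
  rewrite /= tswap_tens lslice_tens rslice_tens.
Qed.
End Swap.

Lemma tswapK (K : fieldType) (A B : lmodType K) : cancel (@tswap K A B) (@tswap K B A).
Proof.
by move=> x; apply: (tensor_eq (f := @tswap K B A \o @tswap K A B) (g := idfun)) => a b;
  rewrite /= !tswap_tens.
Qed.

Lemma tensor_rslice0 (K : fieldType) (A B : lmodType K)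
    (W : {scalar B} -> Prop) (x : tensor A B) :
  separating W -> (forall w, W w -> rslice w x = 0) -> x = 0.
Proof.
move=> sepW x0; rewrite -[x]tswapK (_ : tswap x = 0) ?linear0//.
by apply: (tensor_lslice0 sepW) => w /x0; rewrite lslice_tswap.
Qed.

Lemma lslice_tmap (K : fieldType) (A B A' B' : lmodType K) (w : {scalar A'})
    (f : {linear A -> A'}) (g : {linear B -> B'}) x :
  lslice w (tmap f g x) = g (lslice (w \o f) x).
Proof.
by apply: (tensor_eq (f := lslice w \o tmap f g) (g := g \o lslice (w \o f))) => a b;
  rewrite /= tmap_tensE !lslice_tens linearZ.
Qed.

Lemma rslice_tmap (K : fieldType) (A B A' B' : lmodType K) (w : {scalar B'})
    (f : {linear A -> A'}) (g : {linear B -> B'}) x :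
  rslice w (tmap f g x) = f (rslice (w \o g) x).
Proof.
by apply: (tensor_eq (f := rslice w \o tmap f g) (g := f \o rslice (w \o g))) => a b;
  rewrite /= tmap_tensE !rslice_tens linearZ.
Qed.

Lemma slice_comm (K : fieldType) (A B : lmodType K) (f : {scalar A})
    (g : {scalar B}) (x : tensor A B) : g (lslice f x) = f (rslice g x).
Proof.
apply: (tensor_eq (V := K^o) (f := g \o lslice f) (g := f \o rslice g)) => a b.
by rewrite /= lslice_tens rslice_tens !linearZ; apply: mulrC.
Qed.

Lemma tmap_comp (K : fieldType) (A B A' B' A'' B'' : lmodType K)
    (f : {linear A -> A'}) (g : {linear B -> B'})
    (f' : {linear A' -> A''}) (g' : {linear B' -> B''}) x :
  tmap f' g' (tmap f g x) = tmap (f' \o f) (g' \o g) x.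
Proof.
by apply: (tensor_eq (f := tmap f' g' \o tmap f g) (g := tmap (f' \o f) (g' \o g)))
  => a b; rewrite /= !tmap_tensE.
Qed.

Lemma tmap_id (K : fieldType) (A B : lmodType K) (f : {linear A -> A})
    (g : {linear B -> B}) x : f =1 id -> g =1 id -> tmap f g x = x.
Proof.
by move=> f1 g1; apply: (tensor_eq (f := tmap f g) (g := idfun)) => a b;
  rewrite /= tmap_tensE f1 g1.
Qed.

(** * Multipliers of non-unital algebras *)

(** The side is a boolean so that a statement and its mirror image are proved at once. *)
Definition mulb (K : fieldType) (A : nuAlgType K) (s : bool) (b a : A) : A :=
  if s then b ** a else a ** b.

Arguments mulb : simpl never.

Section OneSidedProduct.
Variables (K : fieldType) (A : nuAlgType K).

Lemma mulb_linear s (b : A) : linear (mulb s b).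
Proof.
by case: s => k u v; rewrite /mulb ?numulDr ?numulZr ?numulDl ?numulZl.
Qed.
HB.instance Definition _ s (b : A) :=
  GRing.isLinear.Build K A A *:%R (mulb s b) (mulb_linear s b).

End OneSidedProduct.

Section OneSidedProducts.
Variables (K : fieldType) (A B : nuAlgType K).

Lemma nondegenerate_cancel s (a : A) : nondegenerate A ->
  (forall b, mulb s b a = 0) -> a = 0.
Proof. by move=> /(_ a)[H1 H2]; case: s => ab; [apply: H2|apply: H1]. Qed.

Lemma nondegenerate_inj s (a a' : A) : nondegenerate A ->
  (forall b, mulb s b a = mulb s b a') -> a = a'.
Proof.
move=> ndA aa'; apply/eqP; rewrite -subr_eq0; apply/eqP.
by apply: (nondegenerate_cancel (s := s) ndA) => b; rewrite linearB /= aa' subrr.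
Qed.

Lemma mulb_tens s (a : A) (b : B) x :
  mulb s (a \ox b) x = tmap (mulb s a) (mulb s b) x.
Proof.
apply: (tensor_eq (f := mulb s (a \ox b)) (g := tmap (mulb s a) (mulb s b))) => c d.
by rewrite /= tmap_tensE; case: s; rewrite /mulb numul_tens.
Qed.

Lemma separating_mulb s : nondegenerate A ->
  separating (fun w : {scalar A} => exists (f : {scalar A}) (b : A),
    w = (f \o mulb s b : {scalar A})).
Proof.
move=> ndA a wa; apply: (nondegenerate_cancel (s := s) ndA) => b.
by apply: separatingT => f _; apply: (wa (f \o mulb s b)); exists f, b.
Qed.

End OneSidedProducts.

Section Multipliers.
Variables (K : fieldType) (A : nuAlgType K).
Implicit Types (m n : mult A).

Lemma lactE k m n a : lact (k *: m + n) a = k *: lact m a + lact n a.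
Proof. by []. Qed.
Lemma ractE k m n a : ract (k *: m + n) a = k *: ract m a + ract n a.
Proof. by []. Qed.

Lemma to_mult_linear : linear (@to_mult K A).
Proof.
move=> k a b; apply: mult_ext => c; rewrite ?lactE ?ractE /=.
  by rewrite /lact /= numulDl numulZl.
by rewrite /ract /= numulDr numulZr.
Qed.
HB.instance Definition _ :=
  GRing.isLinear.Build K A (mult A) *:%R (@to_mult K A) to_mult_linear.

Lemma to_mult_inj : nondegenerate A -> injective (@to_mult K A).
Proof.
move=> ndA a b ab; apply: (nondegenerate_inj (s := false) ndA) => c.
by rewrite /mulb -[a ** c]/(lact (to_mult a) c) ab.
Qed.

Lemma to_mult_lact m a : to_mult (lact m a) = m * to_mult a.
Proof.
have [_ _ lM _ lrM] := multP m.
by apply: mult_ext => b; [exact: (esym (lM a b))|exact: (esym (lrM b a))].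
Qed.

Lemma to_mult_ract m a : to_mult (ract m a) = to_mult a * m.
Proof.
have [_ _ _ rM lrM] := multP m.
by apply: mult_ext => b; [exact: (lrM a b)|exact: (esym (rM b a))].
Qed.

Lemma of_multE m : Defs.in_alg m -> to_mult (of_mult m) = m.
Proof. by case=> x xm; rewrite /of_mult; case: xgetP => [y _ //|/(_ x)]. Qed.

Lemma to_multK (a : A) : nondegenerate A -> of_mult (to_mult a) = a.
Proof. by move=> ndA; apply: (to_mult_inj ndA); apply: of_multE; exists a. Qed.

End Multipliers.

Section TensorMultipliers.
Variables (K : fieldType) (A B : nuAlgType K).

(** Slicing the product of [c \ox d] and [x] by [f] gives the product of [d] with the slice of [x]
    by f(c .) or f(. c), and these functionals separate points. *)
Lemma tensor_nondegenerate : nondegenerate A -> nondegenerate B ->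
  nondegenerate (tensor A B).
Proof.
move=> ndA ndB x.
have cancel s : (forall y, mulb s y x = 0) -> x = 0.
  move=> xy; apply: (tensor_lslice0 (separating_mulb (s := s) ndA)).
  move=> _ [f [c ->]]; apply: (nondegenerate_cancel (s := s) ndB) => d.
  by rewrite -lslice_tmap -mulb_tens xy linear0.
by split; [apply: (cancel false)|apply: (cancel true)].
Qed.

Lemma lact_tens (m : mult A) (n : mult B) x :
  lact (m \oxm n) x = tmap (lact m) (lact n) x.
Proof. by []. Qed.
Lemma ract_tens (m : mult A) (n : mult B) x :
  ract (m \oxm n) x = tmap (ract m) (ract n) x.
Proof. by []. Qed.

Lemma tensor_mult_ext (m n : mult (tensor A B)) :
  (forall a b, lact m (a \ox b) = lact n (a \ox b)) ->
  (forall a b, ract m (a \ox b) = ract n (a \ox b)) -> m = n.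
Proof. by move=> ml mr; apply: mult_ext; apply: tensor_eq. Qed.

Lemma tens_mult_bilinear :
  bilinear_for *:%R *:%R (fun (m : mult A) (n : mult B) => m \oxm n).
Proof.
split=> p k m m'; apply: tensor_mult_ext => a b /=.
- rewrite [RHS](lactE k (m \oxm p) (m' \oxm p)) !lact_tens !tmap_tensE /= (lactE k m m').
  exact: (tens_bilinear A B).1.
- rewrite [RHS](ractE k (m \oxm p) (m' \oxm p)) !ract_tens !tmap_tensE /= (ractE k m m').
  exact: (tens_bilinear A B).1.
- rewrite [RHS](lactE k (p \oxm m) (p \oxm m')) !lact_tens !tmap_tensE /= (lactE k m m').
  exact: (tens_bilinear A B).2.
- rewrite [RHS](ractE k (p \oxm m) (p \oxm m')) !ract_tens !tmap_tensE /= (ractE k m m').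
  exact: (tens_bilinear A B).2.
Qed.

End TensorMultipliers.

Section TensMultMap.
Variables (K : fieldType) (A A' B B' : nuAlgType K).
Variables (F : {linear A -> mult B}) (G : {linear A' -> mult B'}).

Lemma tens_mult_map_bilinear : bilinear_for *:%R *:%R (fun a b => F a \oxm G b).
Proof.
split=> b k u v; first by rewrite linearP; exact: (tens_mult_bilinear _ _).1.
by rewrite linearP; exact: (tens_mult_bilinear _ _).2.
Qed.

Definition tens_mult_map : {linear tensor A A' -> mult (tensor B B')} :=
  mk_linear (tlift_is_linear tens_mult_map_bilinear).

Lemma tens_mult_mapE x : tens_mult_map x = tlift (fun a b => F a \oxm G b) x.
Proof. exact: mk_linearE. Qed.

Lemma tens_mult_map_tens a b : tens_mult_map (a \ox b) = F a \oxm G b.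
Proof. by rewrite tens_mult_mapE tlift_tens//; apply: tens_mult_map_bilinear. Qed.

End TensMultMap.

(** * Compression of multipliers by a conditional expectation *)

Section Assoc.
Variables (K : fieldType) (A B D : lmodType K).

Lemma tassoc_inner_bilinear (d : D) :
  bilinear_for *:%R *:%R (fun (a : A) (b : B) => a \ox (b \ox d)).
Proof.
split=> c k u v; first exact: (tens_bilinear A (tensor B D)).1.
by rewrite ((tens_bilinear B D).1 d k u v) /= tensDr tensZr.
Qed.

Lemma tassoc_bilinear : bilinear_for *:%R *:%R
  (fun (x : tensor A B) (d : D) => tlift (fun a b => a \ox (b \ox d)) x).
Proof.
split=> [d|x]; first exact: tlift_is_linear (tassoc_inner_bilinear d).
apply: (tlift_lin (g := fun d a b => a \ox (b \ox d))) => a b k u v.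
by rewrite ((tens_bilinear B D).2 b k u v) /= tensDr tensZr.
Qed.

HB.instance Definition _ :=
  GRing.isLinear.Build K (tensor (tensor A B) D) (tensor A (tensor B D)) *:%R
    (@tassoc K A B D) (tlift_is_linear tassoc_bilinear).

Lemma tassoc_tens a b d : @tassoc K A B D ((a \ox b) \ox d) = a \ox (b \ox d).
Proof.
by rewrite /tassoc tlift_tens ?tlift_tens//;
  [apply: tassoc_inner_bilinear|apply: tassoc_bilinear].
Qed.

Lemma tensor3_eq (V : lmodType K) (f g : {linear tensor (tensor A B) D -> V}) :
  (forall a b d, f ((a \ox b) \ox d) = g ((a \ox b) \ox d)) -> f =1 g.
Proof.
move=> fg; apply: tensor_eq => x d; elim/tensor_ind: x => [|x y fx fy|//].
  by rewrite tens0l !linear0.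
by rewrite tensDl !linearD fx fy.
Qed.

End Assoc.

Lemma tassoc_tmap (K : fieldType) (A B D A' B' D' : lmodType K)
    (f : {linear A -> A'}) (g : {linear B -> B'}) (k : {linear D -> D'}) x :
  tassoc (tmap (tmap f g) k x) = tmap f (tmap g k) (tassoc x).
Proof.
apply: (tensor3_eq (f := @tassoc _ _ _ _ \o tmap (tmap f g) k)
                   (g := tmap f (tmap g k) \o @tassoc _ _ _ _)) => a b d.
by rewrite /= tassoc_tens !tmap_tensE /= !tmap_tensE tassoc_tens.
Qed.

(* The inclusion of a subalgebra D of A (up to isomorphism) together with a
   D-bimodule projection of A onto D. *)
Record cond_expectation (K : fieldType) (A D : nuAlgType K) := CondExpectation {
  ce_incl : {linear D -> A};
  ce_proj : {linear A -> D};
  ce_inclM : forall d e, ce_incl (d ** e) = ce_incl d ** ce_incl e;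
  ce_inclK : cancel ce_incl ce_proj;
  ce_projMl : forall d a, ce_proj (ce_incl d ** a) = d ** ce_proj a;
  ce_projMr : forall a d, ce_proj (a ** ce_incl d) = ce_proj a ** d
}.

Section Compression.
Variables (K : fieldType) (A D : nuAlgType K) (c : cond_expectation A D).
Let v := ce_incl c.
Let p := ce_proj c.

(** The two actions are compatible because, by the bimodule property, p(a m) b and a p(m b) are both
    p(a m b) for [a] and [b] in D. *)
Lemma compress_subproof (m : mult A) : multb (p \o lact m \o v, p \o ract m \o v).
Proof.
have [_ _ lM rM lrM] := multP m.
apply/asboolP; split=> [k a b|k a b|a b|a b|a b] /=.
- by rewrite !linearP.
- by rewrite !linearP.
- by rewrite [v _]ce_inclM [lact _ _]lM [p _]ce_projMr.
- by rewrite [v _]ce_inclM [ract _ _]rM [p _]ce_projMl.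
- by rewrite -[LHS]ce_projMr -[RHS]ce_projMl; congr (ce_proj c _); apply: lrM.
Qed.
Definition compress (m : mult A) : mult D := Mult (compress_subproof m).

Lemma lact_compress m d : lact (compress m) d = p (lact m (v d)). Proof. by []. Qed.
Lemma ract_compress m d : ract (compress m) d = p (ract m (v d)). Proof. by []. Qed.

Lemma compress_linear : linear compress.
Proof.
move=> k m n; apply: mult_ext => d.
  rewrite [RHS]lactE !lact_compress lactE linearP; reflexivity.
rewrite [RHS]ractE !ract_compress ractE linearP; reflexivity.
Qed.
HB.instance Definition _ :=
  GRing.isLinear.Build K (mult A) (mult D) *:%R compress compress_linear.

Lemma compress_to_mult a : compress (to_mult a) = to_mult (p a).
Proof. by apply: mult_ext => d; [exact: ce_projMr|exact: ce_projMl]. Qed.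

(** Compression is not multiplicative in general. It is when one factor commutes with both inclusion
    and projection, as multiplication by elements of D in some legs does; nothing more is required
    for coassociativity. *)
Definition ce_compatible (m : mult A) (n : mult D) : Prop :=
  [/\ forall d, lact m (v d) = v (lact n d), forall d, ract m (v d) = v (ract n d),
      forall a, p (lact m a) = lact n (p a) & forall a, p (ract m a) = ract n (p a)].

Lemma compress_mull m n m' : ce_compatible m n ->
  compress (m * m') = n * compress m'.
Proof.
by case=> mv mv' pm pm'; apply: mult_ext => d;
  [exact: pm|exact: (congr1 (fun z => p (ract m' z)) (mv' d))].
Qed.

Lemma compress_mulr m n m' : ce_compatible m n ->
  compress (m' * m) = compress m' * n.
Proof.
by case=> mv mv' pm pm'; apply: mult_ext => d;
  [exact: (congr1 (fun z => p (lact m' z)) (mv d))|exact: pm'].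
Qed.

Lemma ce_compatible1 : ce_compatible 1 1.
Proof. by []. Qed.

Lemma ce_compatible_incl d : ce_compatible (to_mult (v d)) (to_mult d).
Proof.
split=> x; [exact: (esym (ce_inclM c d x))|exact: (esym (ce_inclM c x d))| |].
  exact: ce_projMl.
exact: ce_projMr.
Qed.

End Compression.

Section TensorCompression.
Variables (K : fieldType) (A D B E : nuAlgType K).
Variables (c : cond_expectation A D) (c' : cond_expectation B E).

Lemma numul_tmap (V W V' W' : nuAlgType K) (f : {linear V -> V'})
    (g : {linear W -> W'}) x y :
  {morph f : a b / a ** b} -> {morph g : a b / a ** b} ->
  tmap f g (x ** y) = tmap f g x ** tmap f g y.
Proof.
move=> fM gM; elim/tensor_ind: x => [|x x' Hx Hx'|a b].
- by rewrite numul0l !linear0 numul0l.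
- by rewrite numulDl !linearD /= numulDl Hx Hx'.
elim/tensor_ind: y => [|y y' Hy Hy'|a' b'].
- by rewrite numul0r !linear0 numul0r.
- by rewrite numulDr !linearD /= numulDr Hy Hy'.
by rewrite numul_tens !tmap_tensE fM gM numul_tens.
Qed.

Let v : {linear tensor D E -> tensor A B} := tmap (ce_incl c) (ce_incl c').
Let p : {linear tensor A B -> tensor D E} := tmap (ce_proj c) (ce_proj c').

Let vM d e : v (d ** e) = v d ** v e.
Proof. by apply: numul_tmap => a b; apply: ce_inclM. Qed.
Let vK : cancel v p.
Proof. by move=> d; rewrite /p /v /= tmap_comp; apply: tmap_id => x; apply: ce_inclK. Qed.
Let pMl d a : p (v d ** a) = d ** p a.
Proof.
elim/tensor_ind: d => [|x x' Hx Hx'|d e].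
- by rewrite linear0 !numul0l linear0.
- by rewrite linearD numulDl linearD Hx Hx' numulDl.
elim/tensor_ind: a => [|y y' Hy Hy'|a b].
- by rewrite numul0r !linear0 numul0r.
- by rewrite numulDr !linearD Hy Hy' numulDr.
by rewrite /v /p /= !tmap_tensE !numul_tens !tmap_tensE !ce_projMl.
Qed.
Let pMr a d : p (a ** v d) = p a ** d.
Proof.
elim/tensor_ind: d => [|x x' Hx Hx'|d e].
- by rewrite linear0 !numul0r linear0.
- by rewrite linearD numulDr linearD Hx Hx' numulDr.
elim/tensor_ind: a => [|y y' Hy Hy'|a b].
- by rewrite numul0l !linear0 numul0l.
- by rewrite numulDl !linearD Hy Hy' numulDl.
by rewrite /v /p /= !tmap_tensE !numul_tens !tmap_tensE !ce_projMr.
Qed.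

Definition ce_tensor : cond_expectation (tensor A B) (tensor D E) :=
  CondExpectation vM vK pMl pMr.

Lemma compress_tens m n :
  compress ce_tensor (m \oxm n) = compress c m \oxm compress c' n.
Proof.
apply: tensor_mult_ext => a b.
  rewrite lact_compress !lact_tens /= !tmap_tensE /=; reflexivity.
rewrite ract_compress !ract_tens /= !tmap_tensE /=; reflexivity.
Qed.

Lemma ce_compatible_tens m n m' n' : ce_compatible c m n ->
  ce_compatible c' m' n' -> ce_compatible ce_tensor (m \oxm m') (n \oxm n').
Proof.
move=> [h1 h2 h3 h4] [h1' h2' h3' h4']; split.
- apply: (tensor_eq (f := lact (m \oxm m') \o v) (g := v \o lact (n \oxm n'))) => a b.
  rewrite /v /= !lact_tens (tmap_tensE (ce_incl c)) (tmap_tensE (lact m)).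
  by rewrite (tmap_tensE (lact n)) (tmap_tensE (ce_incl c)) /= h1 h1'.
- apply: (tensor_eq (f := ract (m \oxm m') \o v) (g := v \o ract (n \oxm n'))) => a b.
  rewrite /v /= !ract_tens (tmap_tensE (ce_incl c)) (tmap_tensE (ract m)).
  by rewrite (tmap_tensE (ract n)) (tmap_tensE (ce_incl c)) /= h2 h2'.
- apply: (tensor_eq (f := p \o lact (m \oxm m')) (g := lact (n \oxm n') \o p)) => a b.
  rewrite /p /= !lact_tens (tmap_tensE (ce_proj c)) (tmap_tensE (lact m)).
  by rewrite (tmap_tensE (lact n)) (tmap_tensE (ce_proj c)) /= h3 h3'.
- apply: (tensor_eq (f := p \o ract (m \oxm m')) (g := ract (n \oxm n') \o p)) => a b.
  rewrite /p /= !ract_tens (tmap_tensE (ce_proj c)) (tmap_tensE (ract m)).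
  by rewrite (tmap_tensE (ract n)) (tmap_tensE (ce_proj c)) /= h4 h4'.
Qed.

End TensorCompression.

Lemma compress_assoc (K : fieldType) (A D : nuAlgType K) (c : cond_expectation A D)
    (m : mult (tensor (tensor A A) A)) (n : mult (tensor A (tensor A A))) :
  mult_assoc_eq m n ->
  mult_assoc_eq (compress (ce_tensor (ce_tensor c c) c) m)
                (compress (ce_tensor c (ce_tensor c c)) n).
Proof.
move=> mn x; have [mnl mnr] := mn (ce_incl (ce_tensor (ce_tensor c c) c) x).
rewrite !lact_compress !ract_compress /= !tassoc_tmap mnl mnr.
by rewrite !tassoc_tmap.
Qed.

Lemma lslice_ext (K : fieldType) (A B : lmodType K) (w w' : A -> K)
  (x : tensor A B) : w =1 w' -> lslice w x = lslice w' x.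
Proof. by move=> /funext->. Qed.
Lemma rslice_ext (K : fieldType) (A B : lmodType K) (w w' : B -> K)
  (x : tensor A B) : w =1 w' -> rslice w x = rslice w' x.
Proof. by move=> /funext->. Qed.

Section OneLegProducts.
Variables (K : fieldType) (A : nuAlgType K).
Implicit Types (x y : tensor A A) (m n : mult (tensor A A)) (f : {scalar A}).

Definition mulm s m n : mult (tensor A A) := if s then m * n else n * m.

Definition mulb1 s c : {linear tensor A A -> tensor A A} :=
  tmap (mulb s c) (@idfun A).
Definition mulb2 s c : {linear tensor A A -> tensor A A} :=
  tmap (@idfun A) (mulb s c).

Definition fmul (f : {scalar A}) s (c : A) : {scalar A} := f \o mulb s c.
Lemma fmulE f s c a : fmul f s c a = f (mulb s c a). Proof. by []. Qed.

Lemma to_mult_mulb1 s c x : to_mult (mulb1 s c x) = mulm s (ml c) (to_mult x).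
Proof. by case: s; [exact: to_mult_lact (ml c) x|exact: to_mult_ract (ml c) x]. Qed.
Lemma to_mult_mulb2 s c x : to_mult (mulb2 s c x) = mulm s (mr c) (to_mult x).
Proof. by case: s; [exact: to_mult_lact (mr c) x|exact: to_mult_ract (mr c) x]. Qed.

Lemma mulm_mlr s c s' b m :
  mulm s (ml c) (mulm s' (mr b) m) = mulm s' (mr b) (mulm s (ml c) m).
Proof.
have mlr : ml c * mr b = mr b * ml c :> mult (tensor A A).
  apply: tensor_mult_ext => p q.
    have E (u u' w w' : mult A) : lact ((u \oxm w) * (u' \oxm w')) (p \ox q) =
        lact u (lact u' p) \ox lact w (lact w' q).
      rewrite -[LHS]/(tmap (lact u) (lact w) (tmap (lact u') (lact w') (p \ox q))).
      by rewrite (tmap_tensE (lact u')) (tmap_tensE (lact u)).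
    by rewrite !E.
  have E (u u' w w' : mult A) : ract ((u \oxm w) * (u' \oxm w')) (p \ox q) =
      ract u' (ract u p) \ox ract w' (ract w q).
    rewrite -[LHS]/(tmap (ract u') (ract w') (tmap (ract u) (ract w) (p \ox q))).
    by rewrite (tmap_tensE (ract u)) (tmap_tensE (ract u')).
  by rewrite !E.
case: s s' => -[]; rewrite /mulm ?mulrA//; first by rewrite mlr.
by rewrite -!mulrA mlr.
Qed.

Lemma lslice_mulb1 f s c x : lslice f (mulb1 s c x) = lslice (fmul f s c) x.
Proof. exact: lslice_tmap. Qed.
Lemma lslice_mulb2 f s c x : lslice f (mulb2 s c x) = mulb s c (lslice f x).
Proof. exact: lslice_tmap. Qed.
Lemma rslice_mulb1 f s c x : rslice f (mulb1 s c x) = mulb s c (rslice f x).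
Proof. exact: rslice_tmap. Qed.
Lemma rslice_mulb2 f s c x : rslice f (mulb2 s c x) = rslice (fmul f s c) x.
Proof. exact: rslice_tmap. Qed.

Lemma tensor_lslice_eq x y :
  (forall f : {scalar A}, lslice f x = lslice f y) -> x = y.
Proof.
move=> xy; apply/eqP; rewrite -subr_eq0; apply/eqP.
apply: (tensor_lslice0 (@separatingT _ _)) => f _.
by rewrite linearB /= xy subrr.
Qed.
Lemma tensor_rslice_eq x y :
  (forall f : {scalar A}, rslice f x = rslice f y) -> x = y.
Proof.
move=> xy; apply/eqP; rewrite -subr_eq0; apply/eqP.
apply: (tensor_rslice0 (@separatingT _ _)) => f _.
by rewrite linearB /= xy subrr.
Qed.

Hypothesis ndA : nondegenerate A.

Lemma mulb1_inj s x y : (forall c, mulb1 s c x = mulb1 s c y) -> x = y.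
Proof.
move=> xy; apply: tensor_rslice_eq => f; apply: (nondegenerate_inj (s := s) ndA) => c.
by rewrite -!rslice_mulb1 xy.
Qed.
Lemma mulb2_inj s x y : (forall c, mulb2 s c x = mulb2 s c y) -> x = y.
Proof.
move=> xy; apply: tensor_lslice_eq => f; apply: (nondegenerate_inj (s := s) ndA) => c.
by rewrite -!lslice_mulb2 xy.
Qed.

Lemma mulb1_tmap s c (g : {linear A -> A}) x :
  mulb1 s c (tmap idfun g x) = tmap idfun g (mulb1 s c x).
Proof. by rewrite /mulb1 /= !tmap_comp. Qed.
Lemma mulb2_tmap s c (g : {linear A -> A}) x :
  mulb2 s c (tmap g idfun x) = tmap g idfun (mulb2 s c x).
Proof. by rewrite /mulb2 /= !tmap_comp. Qed.

End OneLegProducts.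
Arguments mulb1 : simpl never.
Arguments mulb2 : simpl never.
Arguments fmul : simpl never.

Section MultStar.
Variables (K : numClosedFieldType) (A : starAlgType K).

Lemma lact_star (m : mult A) a : lact (mult_star m) a = star (ract m (star a)).
Proof. by []. Qed.
Lemma ract_star (m : mult A) a : ract (mult_star m) a = star (lact m (star a)).
Proof. by []. Qed.

Lemma mult_starM (m n : mult A) : mult_star (m * n) = mult_star n * mult_star m.
Proof.
apply: mult_ext => a.
  have E (u v : mult A) b : lact (u * v) b = lact u (lact v b) by [].
  have F (u v : mult A) b : ract (u * v) b = ract v (ract u b) by [].
  by rewrite E !lact_star starK F.
have E (u v : mult A) b : lact (u * v) b = lact u (lact v b) by [].
have F (u v : mult A) b : ract (u * v) b = ract v (ract u b) by [].
by rewrite F !ract_star starK E.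
Qed.

Lemma mult_star_to_mult (a : A) : mult_star (to_mult a) = to_mult (star a).
Proof.
apply: mult_ext => b.
  by rewrite lact_star -[LHS]/(star (star b ** a)) starM starK.
by rewrite ract_star -[LHS]/(star (a ** star b)) starM starK.
Qed.

Lemma mult_star1 : mult_star (1 : mult A) = 1.
Proof. by apply: mult_ext => b; [rewrite lact_star|rewrite ract_star]; apply: starK. Qed.

End MultStar.

Lemma star0 (K : numClosedFieldType) (A : starAlgType K) : star (0 : A) = 0.
Proof. by rewrite -[X in star X](scale0r 0) starZ rmorph0 scale0r. Qed.

Lemma star_tens (K : numClosedFieldType) (A B : starAlgType K) (a : A) (b : B) :
  star (a \ox b : tensor A B) = star a \ox star b.
Proof. exact: tstar_tens. Qed.

Lemma mult_star_tens (K : numClosedFieldType) (A B : starAlgType K)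
    (m : mult A) (n : mult B) :
  mult_star (m \oxm n) = mult_star m \oxm mult_star n.
Proof.
apply: tensor_mult_ext => a b.
  rewrite lact_star star_tens !(ract_tens, lact_tens) (tmap_tensE (ract m)) star_tens.
  by rewrite (tmap_tensE (lact (mult_star m))).
rewrite ract_star star_tens !(ract_tens, lact_tens) (tmap_tensE (lact m)) star_tens.
by rewrite (tmap_tensE (ract (mult_star m))).
Qed.

(** * Slices of the coproduct *)

(* [Rfun f s b] stands for the functional f(b .) if s, and f(. b) otherwise:
   these are the functionals w for which (w (x) iota) Delta and
   (iota (x) w) Delta map A to itself. *)
Record rfun (K : fieldType) (A : nuAlgType K) := Rfun {
  rfun_fun : {scalar A}; rfun_side : bool; rfun_elt : A
}.
Definition rval (K : fieldType) (A : nuAlgType K) (r : rfun A) : {scalar A} :=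
  fmul (rfun_fun r) (rfun_side r) (rfun_elt r).

Section SlicedCoproduct.
Variables (K : numClosedFieldType) (A : starAlgType K).
Variable Delta : {linear A -> mult (tensor A A)}.
Hypothesis HD : multiplier_Hopf_star Delta.

Let ndA : nondegenerate A := mhs_nondegenerate HD.
Let ndAA : nondegenerate (tensor A A) := tensor_nondegenerate ndA ndA.

(** The axioms only give Delta(a) (1 (x) b) and, for the first leg, (b (x) 1) Delta(a); the products
    on the other side are their adjoints. *)
Lemma Delta_side2 s b a : Defs.in_alg (mulm s (mr b) (Delta a)).
Proof.
have [T _ TE] := mhs_T1 HD; case: s; last by exists (T (a \ox b)); apply: TE.
exists (star (T (star a \ox star b))); rewrite -mult_star_to_mult TE mult_starM.
by rewrite -(mhs_star HD) starK /mr mult_star_tens mult_star1 mult_star_to_mult starK.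
Qed.

Lemma Delta_side1 s b a : Defs.in_alg (mulm s (ml b) (Delta a)).
Proof.
have [T _ TE] := mhs_T2 HD; case: s; first by exists (T (b \ox a)); apply: TE.
exists (star (T (star b \ox star a))); rewrite -mult_star_to_mult TE mult_starM.
by rewrite -(mhs_star HD) starK /ml mult_star_tens mult_star1 mult_star_to_mult starK.
Qed.

Let mulm_linear (s : bool) (m : mult (tensor A A)) : linear (mulm s m \o Delta).
Proof.
move=> k a b; rewrite /= linearP /=; case: s; rewrite /mulm; apply: mult_ext => x.
- exact: (lact_is_linear m k (lact (Delta a) x) (lact (Delta b) x)).
- exact: (ractE k (Delta a) (Delta b) (ract m x)).
- exact: (lactE k (Delta a) (Delta b) (lact m x)).
- exact: (ract_is_linear m k (ract (Delta a) x) (ract (Delta b) x)).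
Qed.

Let of_mulm_linear (s : bool) (m : mult (tensor A A)) :
  (forall a, Defs.in_alg (mulm s m (Delta a))) ->
  linear (fun a => of_mult (mulm s m (Delta a))).
Proof.
move=> mD k a b; apply: (to_mult_inj ndAA).
rewrite [RHS]to_mult_linear !of_multE; [exact: (mulm_linear s m)|exact: mD..].
Qed.

(* (1 (x) b) Delta(a) if s, else Delta(a) (1 (x) b); similarly for [cov1]. *)
Definition cov2 s b : {linear A -> tensor A A} :=
  mk_linear (of_mulm_linear (Delta_side2 s b)).
Definition cov1 s b : {linear A -> tensor A A} :=
  mk_linear (of_mulm_linear (Delta_side1 s b)).

Lemma cov2E s b a : to_mult (cov2 s b a) = mulm s (mr b) (Delta a).
Proof. rewrite mk_linearE; exact: of_multE (Delta_side2 s b a). Qed.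
Lemma cov1E s b a : to_mult (cov1 s b a) = mulm s (ml b) (Delta a).
Proof. rewrite mk_linearE; exact: of_multE (Delta_side1 s b a). Qed.

Lemma cov2_of_mult s b a : cov2 s b a = of_mult (mulm s (mr b) (Delta a)).
Proof. exact: mk_linearE. Qed.
Lemma cov1_of_mult s b a : cov1 s b a = of_mult (mulm s (ml b) (Delta a)).
Proof. exact: mk_linearE. Qed.

Definition lop (r : rfun A) : {linear A -> A} :=
  mk_linear (linearP (lslice (rfun_fun r) \o cov1 (rfun_side r) (rfun_elt r))).
Definition rop (r : rfun A) : {linear A -> A} :=
  mk_linear (linearP (rslice (rfun_fun r) \o cov2 (rfun_side r) (rfun_elt r))).

Lemma lopE r a : lop r a = lslice (rfun_fun r) (cov1 (rfun_side r) (rfun_elt r) a).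
Proof. exact: mk_linearE. Qed.
Lemma ropE r a : rop r a = rslice (rfun_fun r) (cov2 (rfun_side r) (rfun_elt r) a).
Proof. exact: mk_linearE. Qed.

Lemma mulb1_cov2 s c s' b a : mulb1 s c (cov2 s' b a) = mulb2 s' b (cov1 s c a).
Proof.
by apply: (to_mult_inj ndAA); rewrite to_mult_mulb1 to_mult_mulb2 cov2E cov1E mulm_mlr.
Qed.

Lemma mulb1_cov1 s c b a : mulb1 s c (cov1 (~~ s) b a) = mulb1 (~~ s) b (cov1 s c a).
Proof.
apply: (to_mult_inj ndAA); rewrite !to_mult_mulb1 !cov1E.
by case: s; rewrite /mulm /= mulrA.
Qed.
Lemma mulb2_cov2 s c b a : mulb2 s c (cov2 (~~ s) b a) = mulb2 (~~ s) b (cov2 s c a).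
Proof.
apply: (to_mult_inj ndAA); rewrite !to_mult_mulb2 !cov2E.
by case: s; rewrite /mulm /= mulrA.
Qed.

(** This characterizes [lop r] as (w (x) iota) Delta: the element stored in [r] acts on the first
    leg and [b] on the second, so the order of the two multiplications is immaterial. *)
Lemma lslice_cov2 r s b a : lslice (rval r) (cov2 s b a) = mulb s b (lop r a).
Proof. by rewrite lopE -[LHS]lslice_mulb1 mulb1_cov2 lslice_mulb2. Qed.
Lemma rslice_cov1 r s b a : rslice (rval r) (cov1 s b a) = mulb s b (rop r a).
Proof. by rewrite ropE -[LHS]rslice_mulb2 -mulb1_cov2 rslice_mulb1. Qed.

Lemma rvalE (f : {scalar A}) s b a : rval (Rfun f s b) a = f (mulb s b a). Proof. by []. Qed.

(** One functional has several presentations as f(b .) or f(. b). Independence of the presentation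
    is what later allows phi(h .) and phi(. h) to be exchanged. *)
Lemma lop_ext r r' : rval r =1 rval r' -> lop r =1 lop r'.
Proof.
move=> rr' a; apply: (nondegenerate_inj (s := false) ndA) => b.
by rewrite -!lslice_cov2; apply: lslice_ext.
Qed.
Lemma rop_ext r r' : rval r =1 rval r' -> rop r =1 rop r'.
Proof.
move=> rr' a; apply: (nondegenerate_inj (s := false) ndA) => b.
by rewrite -!rslice_cov1; apply: rslice_ext.
Qed.

(** Both sides are (w (x) u) Delta(a), with w the functional of [r]. *)
Lemma rval_rop r u a : rval r (rop u a) = rval u (lop r a).
Proof. by rewrite [RHS]fmulE -lslice_cov2 slice_comm ropE. Qed.

Lemma rval_inj a b : (forall r : rfun A, rval r a = rval r b) -> a = b.
Proof.
move=> ab; apply/eqP; rewrite -subr_eq0; apply/eqP.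
apply: (separating_mulb (s := false) ndA) => _ [f [c ->]].
by rewrite linearB; apply/eqP; rewrite subr_eq0; apply/eqP/(ab (Rfun f false c)).
Qed.

Lemma to_mult_tens (x y : A) : to_mult (x \ox y) = mr y * ml x :> mult (tensor A A).
Proof.
apply: tensor_mult_ext => p q.
  rewrite -[RHS]/(tmap id (lact (to_mult y)) (tmap (lact (to_mult x)) id (p \ox q))).
  rewrite (tmap_tensE (lact (to_mult x)) idfun).
  by rewrite (tmap_tensE idfun (lact (to_mult y))) -[LHS]/(_ ** _) numul_tens.
rewrite -[RHS]/(tmap (ract (to_mult x)) id (tmap id (ract (to_mult y)) (p \ox q))).
rewrite (tmap_tensE idfun (ract (to_mult y))).
by rewrite (tmap_tensE (ract (to_mult x)) idfun) -[LHS]/(_ ** _) numul_tens.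
Qed.

Lemma to_mult_tensC (x y : A) : to_mult (x \ox y) = ml x * mr y :> mult (tensor A A).
Proof. by rewrite to_mult_tens; have := mulm_mlr true x true y 1; rewrite /mulm !mulr1. Qed.

Lemma ract_DeltaE a x y : ract (Delta a) (x \ox y) = mulb1 true x (cov2 true y a).
Proof.
apply: (to_mult_inj ndAA); rewrite to_mult_ract to_mult_mulb1 cov2E /mulm mulrA.
by rewrite to_mult_tensC.
Qed.

Lemma cov2Ml b a c : cov2 false b (a ** c) = lact (Delta a) (cov2 false b c).
Proof.
by apply: (to_mult_inj ndAA); rewrite to_mult_lact !cov2E (mhs_mul HD) /mulm mulrA.
Qed.
Lemma cov2Mr b a c : cov2 true b (a ** c) = ract (Delta c) (cov2 true b a).
Proof.
by apply: (to_mult_inj ndAA); rewrite to_mult_ract !cov2E (mhs_mul HD) /mulm mulrA.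
Qed.

Lemma cov1Ml b a c : cov1 false b (a ** c) = lact (Delta a) (cov1 false b c).
Proof.
by apply: (to_mult_inj ndAA); rewrite to_mult_lact !cov1E (mhs_mul HD) /mulm mulrA.
Qed.
Lemma cov1Mr b a c : cov1 true b (a ** c) = ract (Delta c) (cov1 true b a).
Proof.
by apply: (to_mult_inj ndAA); rewrite to_mult_ract !cov1E (mhs_mul HD) /mulm mulrA.
Qed.

Lemma tensor_lval_eq x y :
  (forall (f : {scalar A}) b,
    lslice (rval (Rfun f false b)) x = lslice (rval (Rfun f false b)) y :> A) -> x = y.
Proof.
move=> xy; apply/eqP; rewrite -subr_eq0; apply/eqP.
apply: (tensor_lslice0 (separating_mulb (s := false) ndA)) => _ [f [b ->]].
by rewrite linearB /=; apply/eqP; rewrite subr_eq0; apply/eqP/xy.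
Qed.
Lemma tensor_rval_eq x y :
  (forall (f : {scalar A}) b,
    rslice (rval (Rfun f false b)) x = rslice (rval (Rfun f false b)) y :> A) -> x = y.
Proof.
move=> xy; apply/eqP; rewrite -subr_eq0; apply/eqP.
apply: (tensor_rslice0 (separating_mulb (s := false) ndA)) => _ [f [b ->]].
by rewrite linearB /=; apply/eqP; rewrite subr_eq0; apply/eqP/xy.
Qed.

Lemma lact_DeltaE a x y : lact (Delta a) (x \ox y) = mulb1 false x (cov2 false y a).
Proof.
apply: (to_mult_inj ndAA); rewrite to_mult_lact to_mult_mulb1 cov2E /mulm -mulrA.
by rewrite to_mult_tens.
Qed.

Lemma lact_sum (B : nuAlgType K) (I : Type) (t : seq I) (F : I -> mult B) x :
  lact (\sum_(i <- t) F i) x = \sum_(i <- t) lact (F i) x.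
Proof. exact: (big_morph (fun m => lact m x)). Qed.

Lemma tassoc_slices (f g : {scalar A}) (u : tensor A A) (t : A) :
  rslice g (lslice f (tassoc (u \ox t))) = g t *: lslice f u.
Proof.
elim/tensor_ind: u => [|u v Hu Hv|a b].
- by rewrite tens0l !linear0.
- by rewrite tensDl !linearD /= Hu Hv.
by rewrite tassoc_tens !lslice_tens linearZ /= rslice_tens !scalerA mulrC.
Qed.

(** Coassociativity acting on p (x) z (x) q, with the outer legs sliced by [f] and [g]. The axiom
    has [c] on the left of the first leg and [b] on the right of the third, whence the functionals
    f(c . p) and g(. b q); the middle factor [z] is cancelled by nondegeneracy. *)
Lemma lop_rop_pre (f g : {scalar A}) c p b q a :
  lop (Rfun (fmul f false p) true c) (rop (Rfun (fmul g false q) false b) a) =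
  rop (Rfun (fmul g false q) false b) (lop (Rfun (fmul f false p) true c) a).
Proof.
apply: (nondegenerate_inj (s := false) ndA) => z.
set w := Rfun _ true c.
have := congr1 (fun x => rslice g (lslice f x))
  (mhs_coassociative HD a b c ((p \ox z) \ox q)).1.
rewrite -(mk_linearE (of_mulm_linear (Delta_side2 false b)) a) -/(cov2 false b).
rewrite -(mk_linearE (of_mulm_linear (Delta_side1 true c)) a) -/(cov1 true c).
have -> : rslice g (lslice f (tassoc (lact
    ((to_mult c \oxm 1) \oxm 1 * Delta_l Delta (cov2 false b a))
    ((p \ox z) \ox q)))) =
    mulb false z (lop w (rslice (fmul g false q) (cov2 false b a))).
  rewrite [cov2 false b a]tensor_sum /Delta_l tlift_sum;
    last exact: (tens_mult_map_bilinear Delta (@to_mult K A)).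
  rewrite mulr_sumr lact_sum (linear_sum (@tassoc _ _ _ _)) (linear_sum (lslice f)).
  rewrite (linear_sum (rslice g)) (linear_sum (rslice (fmul g false q))).
  rewrite (linear_sum (lop w)) (linear_sum (mulb false z)) /=; apply: eq_bigr => y _.
  rewrite -[lact _ _]/(tmap (lact (to_mult c \oxm 1)) id
    (tmap (lact (Delta y.1)) (lact (to_mult y.2)) ((p \ox z) \ox q))).
  rewrite (tmap_tensE (lact (Delta y.1))).
  rewrite (tmap_tensE (lact (to_mult c \oxm 1)) idfun) /= tassoc_slices.
  rewrite lact_DeltaE -[lact (to_mult c \oxm 1) _]/(mulb1 true c _).
  rewrite lslice_mulb1 lslice_mulb1 rslice_tens 2!linearZ /= ?fmulE; congr (_ *: _).
  by rewrite -lslice_cov2; apply: lslice_ext => x; rewrite !fmulE /mulb /= numulA.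
have -> : rslice g (lslice f (lact
    (Delta_r Delta (cov1 true c a) * (1 \oxm (1 \oxm to_mult b)))
    (tassoc ((p \ox z) \ox q)))) =
    mulb false z (rop (Rfun g false (b ** q)) (lslice (fmul f false p) (cov1 true c a))).
  rewrite tassoc_tens -[lact _ _]/(lact (Delta_r Delta (cov1 true c a))
    (tmap id (tmap id (lact (to_mult b))) (p \ox (z \ox q)))).
  rewrite (tmap_tensE idfun (tmap idfun (lact (to_mult b)))) /=.
  rewrite (tmap_tensE idfun (lact (to_mult b))) /=.
  rewrite [cov1 true c a]tensor_sum /Delta_r tlift_sum;
    last exact: (tens_mult_map_bilinear (@to_mult K A) Delta).
  rewrite lact_sum (linear_sum (lslice f)) (linear_sum (rslice g)).
  rewrite (linear_sum (lslice (fmul f false p))) (linear_sum (rop _)).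
  rewrite (linear_sum (mulb false z)) /=; apply: eq_bigr => y _.
  rewrite lact_tens (tmap_tensE (lact (to_mult y.1))) lslice_tens.
  rewrite /= lact_DeltaE linearZ /= rslice_mulb1 (lslice_tens (f \o mulb false p)).
  by rewrite 2!linearZ /= ropE.
rewrite [X in _ -> mulb false z (lop w X) = _]ropE => ->; congr (mulb false z _).
by rewrite [lop w a]lopE; apply: rop_ext => x; rewrite !rvalE; congr (g _); apply: numulA.
Qed.

(** Multiplications of the first leg from the left and from the right commute, so the identity for
    one side holds for the other after multiplying, and nondegeneracy cancels the factor. *)
Lemma cov1_comm_flip (g : {linear A -> A}) s a :
  (forall c, cov1 s c (g a) = tmap idfun g (cov1 s c a)) ->
  forall c, cov1 (~~ s) c (g a) = tmap idfun g (cov1 (~~ s) c a).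
Proof.
move=> gs c; apply: (mulb1_inj ndA (s := s)) => b.
by rewrite mulb1_cov1 gs !mulb1_tmap mulb1_cov1.
Qed.

Lemma cov2_comm_flip (g : {linear A -> A}) s a :
  (forall c, cov2 s c (g a) = tmap g idfun (cov2 s c a)) ->
  forall c, cov2 (~~ s) c (g a) = tmap g idfun (cov2 (~~ s) c a).
Proof.
move=> gs c; apply: (mulb2_inj ndA (s := s)) => b.
by rewrite mulb2_cov2 gs !mulb2_tmap mulb2_cov2.
Qed.

(** The auxiliary factors [p] and [q] are removed from the special case one leg at a time: [f] and
    [p] being arbitrary, the first leg holds before slicing, hence for every [r]; the same is then
    done in the other leg. *)
Lemma lop_rop r u a : lop r (rop u a) = rop u (lop r a).
Proof.
have cov1K (g : {scalar A}) b q s c :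
    let k := rop (Rfun (fmul g false q) false b) in
    cov1 s c (k a) = tmap idfun k (cov1 s c a).
  move=> k.
  have cov1T d : cov1 true d (k a) = tmap idfun k (cov1 true d a).
    apply: (mulb1_inj ndA (s := false)) => p; apply: tensor_lslice_eq => f.
    rewrite !lslice_mulb1 -[LHS](lopE (Rfun (fmul f false p) true d)) lop_rop_pre.
    by rewrite [in LHS]lopE [RHS]lslice_tmap.
  by case: s; [exact: cov1T|exact: (cov1_comm_flip cov1T)].
have cov2K s b : cov2 s b (lop r a) = tmap (lop r) idfun (cov2 s b a).
  have cov2F d : cov2 false d (lop r a) = tmap (lop r) idfun (cov2 false d a).
    apply: (mulb2_inj ndA (s := false)) => q; apply: tensor_rslice_eq => g.
    rewrite !rslice_mulb2 -[LHS](ropE (Rfun (fmul g false q) false d)).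
    rewrite [RHS]rslice_tmap -[X in _ = lop r X](ropE (Rfun (fmul g false q) false d)).
    by rewrite !lopE cov1K lslice_tmap.
  by case: s; [exact: (cov2_comm_flip cov2F)|exact: cov2F].
by rewrite !ropE cov2K [LHS]lopE rslice_tmap lopE.
Qed.

End SlicedCoproduct.

(** * Antipode and integral *)

Section Antipode.
Variables (K : numClosedFieldType) (A : starAlgType K).
Variable Delta : {linear A -> mult (tensor A A)}.
Variables (eps : {scalar A}) (S : {linear A -> A}) (phi : {scalar A}).
Hypothesis HD : multiplier_Hopf_star Delta.
Hypothesis Heps : is_counit Delta eps.
Hypothesis HS : is_antipode Delta eps S.
Hypothesis Hphi : left_invariant Delta phi.

Local Notation X1 := (cov1 HD).
Local Notation X2 := (cov2 HD).
Local Notation L := (lop HD).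
Local Notation R := (rop HD).
Let ndA : nondegenerate A := mhs_nondegenerate HD.
Let ndAA : nondegenerate (tensor A A) := tensor_nondegenerate ndA ndA.

Lemma rslice_eps_cov1 s b a : rslice eps (X1 s b a) = mulb s b a.
Proof.
have [_ /(_ a)[_ /(_ b)[HL HR]]] := Heps.
by rewrite cov1_of_mult; case: s; [exact: HR|exact: HL].
Qed.
Lemma lslice_eps_cov2 s b a : lslice eps (X2 s b a) = mulb s b a.
Proof.
have [_ /(_ a)[/(_ b)[HL HR] _]] := Heps.
by rewrite cov2_of_mult; case: s; [exact: HR|exact: HL].
Qed.

Lemma eps_lop r a : eps (L r a) = rval r a.
Proof. by rewrite lopE slice_comm rslice_eps_cov1. Qed.
Lemma eps_rop r a : eps (R r a) = rval r a.
Proof. by rewrite ropE -slice_comm lslice_eps_cov2. Qed.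

Lemma rslice_phi_cov1 s b a : rslice phi (X1 s b a) = phi a *: b.
Proof.
have [HL HR] := Hphi a b.
by rewrite cov1_of_mult; case: s; [exact: HR|exact: HL].
Qed.

Lemma phi_lop f s b a : phi (L (Rfun f s b) a) = phi a * f b.
Proof. by rewrite lopE slice_comm rslice_phi_cov1 linearZ. Qed.

Lemma antipode_bilinear : bilinear_for *:%R *:%R (fun x y : A => S x ** y).
Proof.
split=> b k u v; first by rewrite linearP numulDl numulZl.
by rewrite numulDr numulZr.
Qed.
Definition antipode_mul : {linear tensor A A -> A} :=
  mk_linear (tlift_is_linear antipode_bilinear).
Local Notation mS := antipode_mul.

Lemma antipode_mul_tens x y : mS (x \ox y) = S x ** y.
Proof. by rewrite mk_linearE tlift_tens//; apply: antipode_bilinear. Qed.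

Lemma antipode_mul_cov2 b a : mS (X2 false b a) = eps a *: b.
Proof. by rewrite mk_linearE cov2_of_mult; have [_ /(_ a b)[]] := HS. Qed.

(** In Sweedler notation both sides are a1 (x) a2 b1 f(a3 b2 d). *)
Lemma tmap_rop_cov2 f d b a :
  tmap idfun (R (Rfun f false d)) (X2 false b a) =
  \sum_(p <- repr (X2 false d b)) X2 false p.1 (R (Rfun f false p.2) a).
Proof.
apply: (tensor_lval_eq HD) => g c; set r := Rfun g false c.
rewrite lslice_tmap (lslice_cov2 HD r) (linear_sum (lslice (rval r))).
rewrite ropE /mulb cov2Ml {1}[X2 false d b]tensor_sum.
rewrite (linear_sum (lact _)) (linear_sum (rslice _)); apply: eq_bigr => p _ /=.
rewrite lact_DeltaE rslice_mulb1 -[rslice f _](ropE HD (Rfun f false p.2)) -lop_rop.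
exact/esym/(lslice_cov2 HD r).
Qed.

(* Strong left invariance.  With Sweedler indices, S(a1) a2 b1 (x) a3 b2 is
   b1 (x) a b2; integrating the second leg gives S(a1) phi(a2 b) = b1 phi(a b2). *)
Lemma antipode_rop a b : S (R (Rfun phi false b) a) = R (Rfun phi true a) b.
Proof.
apply: (nondegenerate_inj (s := true) ndA) => c.
pose T := X2 false b a.
(* The factor [c] makes [Z1] = c S(a1) a2 b1 (x) a3 b2 and [Z2] = c b1 (x) a b2 genuine elements of
   A (x) A; nondegeneracy removes it at the end. *)
pose Z1 := \sum_(y <- repr T) X1 true (c ** S y.1) y.2.
pose Z2 := mulb1 true c (X2 true a b).
have Z12 : Z1 = Z2.
  apply: (tensor_rval_eq HD) => f d; set v := Rfun f false d.
  have -> : rslice (rval v) Z1 = mulb true c (mS (tmap idfun (R v) T)).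
    rewrite [T in RHS]tensor_sum (linear_sum (rslice _)) (linear_sum (tmap _ _)).
    rewrite (linear_sum mS) (linear_sum (mulb true c)); apply: eq_bigr => y _ /=.
    by rewrite (rslice_cov1 HD v) (tmap_tensE idfun (R v)) antipode_mul_tens /mulb numulA.
  rewrite tmap_rop_cov2 (linear_sum mS) /Z2 rslice_mulb1; congr (mulb true c _).
  rewrite -[RHS]rslice_mulb2 mulb2_cov2 rslice_mulb2 {2}[X2 false d b]tensor_sum.
  rewrite (linear_sum (rslice _)); apply: eq_bigr => p _ /=.
  by rewrite antipode_mul_cov2 eps_rop rslice_tens.
have := congr1 (rslice phi) Z12.
rewrite /Z2 rslice_mulb1 -[rslice phi (X2 _ _ _)](ropE HD (Rfun phi true a)).
move=> <-; rewrite ropE (linear_sum (rslice phi)) /= -/T {1}[T]tensor_sum.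
rewrite (linear_sum (rslice phi)) (linear_sum S) (linear_sum (mulb true c)).
apply: eq_bigr => y _ /=.
by rewrite rslice_phi_cov1 rslice_tens !linearZ.
Qed.

End Antipode.

Lemma sub_val_linear (K : fieldType) (A : nuAlgType K) (D : subalgebra A) :
  linear (@sub_val K A D).
Proof. by []. Qed.
HB.instance Definition _ (K : fieldType) (A : nuAlgType K) (D : subalgebra A) :=
  GRing.isLinear.Build K (sub_alg D) A *:%R (@sub_val K A D) (@sub_val_linear K A D).

(** * Group-like projections *)

Section GroupLikeProjection.
Variables (K : numClosedFieldType) (A : starAlgType K).
Variable Delta : {linear A -> mult (tensor A A)}.
Variables (eps : {scalar A}) (S : {linear A -> A}) (phi : {scalar A}) (h : A).
Hypothesis HD : multiplier_Hopf_star Delta.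
Hypothesis Heps : is_counit Delta eps.
Hypothesis HS : is_antipode Delta eps S.
Hypothesis Hphi : positive_left_integral Delta phi.
Hypothesis Hh : group_like_projection Delta h.
Hypothesis phih : phi h = 1.

Local Notation X1 := (cov1 HD).
Local Notation X2 := (cov2 HD).
Local Notation L := (lop HD).
Local Notation R := (rop HD).
Let ndA : nondegenerate A := mhs_nondegenerate HD.
Let ndAA : nondegenerate (tensor A A) := tensor_nondegenerate ndA ndA.
Let phi_inv : left_invariant Delta phi. Proof. by case: Hphi. Qed.
Let phi_ge0 a : 0 <= phi (star a ** a). Proof. by case: Hphi. Qed.
Let SM a b : S (a ** b) = S b ** S a. Proof. by case: HS. Qed.

Lemma cov2_group_like : X2 false h h = h \ox h.
Proof. by apply: (to_mult_inj ndAA); rewrite cov2E; case: Hh. Qed.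

(** Applying the counit to the first leg of Delta(h) (1 (x) h) = h (x) h gives h h = eps(h) h. *)
Lemma eps_group_like : eps h = 1.
Proof.
have [h0 hh _ _] := Hh; have := lslice_eps_cov2 HD Heps false h h.
rewrite cov2_group_like lslice_tens /mulb hh -[RHS]scale1r => /eqP.
rewrite -subr_eq0 -scalerBl scaler_eq0 (negbTE h0) orbF subr_eq0.
by move/eqP.
Qed.

Lemma cov2_span x : exists t : seq (A * A), x = \sum_(p <- t) X2 false p.2 p.1.
Proof.
have [T [T' _ T'K] TE] := mhs_T1 HD; exists (repr (T' x)).
rewrite -[LHS]T'K [T' x in LHS]tensor_sum linear_sum; apply: eq_bigr => p _.
by apply: (to_mult_inj ndAA); rewrite TE cov2E.
Qed.

Lemma mul_span b : exists t : seq (A * A), b = \sum_(p <- t) p.1 ** p.2.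
Proof.
have [t tE] := cov2_span (h \ox b); exists t.
have := congr1 (lslice eps) tE; rewrite lslice_tens eps_group_like scale1r => ->.
by rewrite (linear_sum (lslice eps)); apply: eq_bigr => p _; rewrite /= lslice_eps_cov2.
Qed.

(** Since phi(h) = 1, [b] is the slice of b (x) h by phi, and b (x) h is a sum of elements Delta(x)
    (1 (x) y). Identities about [S] may thus be tested on the elements where strong left invariance
    computes it. *)
Lemma rop_phi_span b :
  exists t : seq (A * A), b = \sum_(p <- t) R (Rfun phi false p.2) p.1.
Proof.
have [t tE] := cov2_span (b \ox h); exists t.
have := congr1 (rslice phi) tE; rewrite rslice_tens phih scale1r => ->.
by rewrite (linear_sum (rslice phi)); apply: eq_bigr => p _; rewrite /= ropE.
Qed.

(** * Hermitian symmetry of the integral and the inverse of the antipode *)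

Let sesqui a b t : phi (star (a + t *: b) ** (a + t *: b)) =
  phi (star a ** a) + t * phi (star a ** b) + t^* * phi (star b ** a) +
  t^* * t * phi (star b ** b).
Proof.
rewrite starD starZ numulDl !numulDr !numulZl !numulZr !linearD !linearZ /=.
by rewrite -!addrA mulrA; congr (_ + (_ + _)).
Qed.

(** Polarization: positivity at a + t b makes [t * y + t^* * x] real, and the values 1 and i of [t]
    suffice. *)
Lemma phi_sesqui a b : phi (star b ** a) = (phi (star a ** b))^*.
Proof.
set x := phi (star b ** a); set y := phi (star a ** b).
have real_conj (z : K) : 0 <= z -> z^* = z by move=> /ger0_real/CrealP.
have lin t : (t * y + t^* * x)^* = t * y + t^* * x.
  have -> : t * y + t^* * x =
      phi (star (a + t *: b) ** (a + t *: b)) -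
      (phi (star a ** a) + t^* * t * phi (star b ** b)).
    by rewrite sesqui -/x -/y; ring.
  by rewrite rmorphB rmorphD !rmorphM /= conjCK !(real_conj (phi _))// (mulrC t).
have := lin 1; have := lin 'i.
rewrite !rmorphD !rmorphM /= !conjCK !conjCi rmorph1 !mul1r => e1 e2.
have : 'i * (x^* - y^*) = 'i * (y - x).
  by move: e1; rewrite !mulNr !mulrBr => /eqP; rewrite addrC => /eqP.
move=> /(mulfI (neq0Ci K)) e3.
apply/eqP; rewrite eq_sym -(inj_eq (mulfI (_ : 2%:R != 0 :> K))) ?pnatr_eq0//.
apply/eqP; have -> : 2%:R * y^* = (x^* + y^*) - (x^* - y^*) by ring.
rewrite e3 [x^* + _]addrC e2; ring.
Qed.
Lemma phi_star a : phi (star a) = (phi a)^*.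
Proof.
have [t ->] := mul_span a.
rewrite (big_morph star (id1 := 0) (op1 := +%R)); [|exact: starD|exact: star0].
rewrite !linear_sum rmorph_sum; apply: eq_bigr => p _ /=.
by rewrite starM -[p.1 in RHS]starK -phi_sesqui.
Qed.

Lemma star_cov2 s b a : star (X2 s b a) = X2 (~~ s) (star b) (star a).
Proof.
apply: (to_mult_inj ndAA); rewrite -mult_star_to_mult !cov2E (mhs_star HD).
have mrS : mult_star (mr b) = mr (star b) :> mult (tensor A A).
  by rewrite /mr mult_star_tens mult_star1 mult_star_to_mult.
by case: s; rewrite /mulm /= mult_starM mrS.
Qed.

Lemma star_rslice_phi (x : tensor A A) : star (rslice phi x) = rslice phi (star x).
Proof.
elim/tensor_ind: x => [|x y Hx Hy|a b]; first by rewrite star0 !linear0 star0.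
  by rewrite starD !linearD /= starD Hx Hy.
by rewrite star_tens !rslice_tens starZ phi_star.
Qed.

Lemma star_rop_phi s b a :
  star (R (Rfun phi s b) a) = R (Rfun phi (~~ s) (star b)) (star a).
Proof. by rewrite !ropE star_rslice_phi star_cov2. Qed.

Let Sinv_linear : linear (star \o S \o star).
Proof. by move=> k a b /=; rewrite starD starZ linearP starD starZ conjCK. Qed.
Definition antipode_inv : {linear A -> A} := mk_linear Sinv_linear.
Local Notation S' := antipode_inv.

Lemma antipode_invE a : S' a = star (S (star a)).
Proof. exact: mk_linearE. Qed.

(** On the spanning elements [S] exchanges the two arguments of the slice and changes its side; the
    involution changes the side back, so a second application of strong left invariance returns the
    original element. *)
Lemma antipodeK : cancel S S'.
Proof.
move=> a; have [t ->] := rop_phi_span a.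
rewrite (linear_sum S) (linear_sum S'); apply: eq_bigr => p _ /=.
rewrite (antipode_rop HD Heps HS phi_inv) antipode_invE star_rop_phi /=.
by rewrite (antipode_rop HD Heps HS phi_inv) star_rop_phi /= !starK.
Qed.

Lemma antipodeVK : cancel S' S.
Proof.
move=> a; apply: (inv_inj (@starK _ A)); rewrite -[RHS]antipodeK.
by rewrite !antipode_invE.
Qed.

(** * Faithfulness of the integral *)

Let phi_null a := forall b, phi (b ** a) = 0.

(** The value phi(b L_r(a)) is [r] applied to the slice of (1 (x) b) Delta(a) by phi, which is [S]
    of the slice of Delta(b) (1 (x) a); the latter vanishes. *)
Let phi_null_lop a r : phi_null a -> phi_null (L r a).
Proof.
move=> a0 b; rewrite -[LHS](rvalE phi true b) -rval_rop.
rewrite -(antipode_rop HD Heps HS phi_inv) (_ : R _ b = 0) ?linear0//.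
apply: (rval_inj HD) => u; rewrite rval_rop rvalE linear0; exact: a0.
Qed.

(** The second legs of Delta(a) (d (x) 1) are again null. With S(d) = h, the antipode identity reads
    S(a1 d) a2 = eps(a) h, and phi kills the left side while phi(h) = 1. *)
Let phi_null_eps a : phi_null a -> eps a = 0.
Proof.
move=> a0; pose d := S' h; pose V : {pred A} := [pred x | `[< phi_null x >]].
have V_closed : submod_closed V.
  split=> [|k x y]; first by apply/asboolP => b; rewrite numul0r linear0.
  move=> /asboolP x0 /asboolP y0; apply/asboolP => b.
  by rewrite numulDr numulZr linearP x0 y0 /= mulr0 addr0.
have [|s /allP sV XE] :=
    tensor_rleg (x := X1 false d a) (@separatingT _ _) V_closed.
  move=> f _; apply/asboolP.
  by rewrite -[lslice f _](lopE HD (Rfun f false d)); apply: phi_null_lop.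
have : antipode_mul S (X1 false d a) = eps a *: h.
  (* The antipode identity is only available for Delta(a) (1 (x) b), hence the extra factor [b]. *)
  apply: (nondegenerate_inj (s := false) ndA) => b.
  have mS2 x : mulb false b (antipode_mul S x) = antipode_mul S (mulb2 false b x).
    apply: (tensor_eq (f := mulb false b \o antipode_mul S)
                      (g := antipode_mul S \o mulb2 false b)) => y z /=.
    by rewrite /mulb2 (tmap_tensE idfun (mulb false b)) !antipode_mul_tens /mulb /= numulA.
  have mS1 x : antipode_mul S (mulb1 false d x) = h ** antipode_mul S x.
    apply: (tensor_eq (f := antipode_mul S \o mulb1 false d)
                      (g := mulb true h \o antipode_mul S)) => y z /=.
    rewrite /mulb1 (tmap_tensE (mulb false d) idfun) !antipode_mul_tens /mulb /=.
    by rewrite SM antipodeVK numulA.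
  by rewrite mS2 -mulb1_cov2 mS1 (antipode_mul_cov2 HD HS) /mulb numulZl numulZr.
rewrite XE (linear_sum (antipode_mul S)) => /(congr1 phi).
rewrite linearZ /= phih mulr1 linear_sum big_seq big1// => p /sV /asboolP p0.
by rewrite /= antipode_mul_tens; apply: p0.
Qed.

(** A Cauchy-Schwarz argument makes [a] null; then every L_r(a) is null, and eps(L_r(a)) = 0 is the
    value of [r] at [a]. *)
Lemma phi_faithful a : phi (star a ** a) = 0 -> a = 0.
Proof.
move=> aa0; have a0 : phi_null a.
  move=> b; rewrite -[b]starK; set c := star b.
  set x := phi (star c ** a); apply/eqP; apply: contrapT => /negP x0.
  have xx0 : 0 < x^* * x by rewrite mulrC mul_conjC_gt0.
  set y := phi (star c ** c).
  have y0 : 0 <= y by apply: phi_ge0.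
  (* Positivity at c - t x^* a would give y - 2 t |x|^2 >= 0; this choice makes the left side -(y +
     2). *)
  pose t := (y + 1) / (x^* * x).
  have t0 : 0 <= t by rewrite divr_ge0 ?addr_ge0 ?ler01 ?(ltW xx0).
  have := phi_ge0 (c + (- t * x^*) *: a).
  rewrite sesqui aa0 -/x -/y phi_sesqui -/x mulr0 addr0.
  rewrite !rmorphM rmorphN /= conjCK (CrealP (ger0_real t0)).
  have -> : y + - t * x^* * x + - t * x * x^* = y - (t * (x^* * x)) *+ 2 by ring.
  rewrite /t mulfVK ?(gt_eqF xx0)// => le0.
  have : y - (y + 1) *+ 2 < 0.
    have -> : y - (y + 1) *+ 2 = - (y + 2%:R) by ring.
    by rewrite oppr_lt0 ltr_wpDl// ltr0n.
  by move=> /lt_geF; rewrite le0.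
apply: (rval_inj HD) => r; rewrite linear0 -(eps_lop HD Heps) phi_null_eps//.
exact: phi_null_lop.
Qed.

(** * The antipode and the coproduct *)

Let SK := antipodeK.
Let S'K := antipodeVK.
Let strong a b : S (R (Rfun phi false b) a) = R (Rfun phi true a) b.
Proof. exact: (antipode_rop HD Heps HS phi_inv). Qed.

(** A presentation of the composite of [rval r] with [S]: f(b S(x)) = f(S(x S'(b))), which is why
    the side is negated. *)
Definition rfun_antipode (r : rfun A) : rfun A :=
  Rfun (rfun_fun r \o S) (~~ rfun_side r) (S' (rfun_elt r)).
Local Notation rS := rfun_antipode.

Lemma rval_antipode r x : rval (rS r) x = rval r (S x).
Proof.
case: r => f s b; rewrite !rvalE /=; congr (f _).
by case: s; rewrite /mulb /= SM S'K.
Qed.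

(** The sliced form of the fact that [S] reverses the coproduct. For a = (iota (x) phi)(Delta(x) (1
    (x) b)), S(a) is a right slice of [b], with which [L r] commutes; tested against [l], both sides
    become phi(L_l(x) L_r(b)). *)
Lemma lop_antipode r a : L r (S a) = S (R (rS r) a).
Proof.
have [t ->] := rop_phi_span a.
rewrite !linear_sum; apply: eq_bigr => -[x b] _ /=.
rewrite strong lop_rop -strong; congr (S _); apply: (rval_inj HD) => l.
by rewrite [RHS]rval_rop rval_antipode lop_rop strong 2!rval_rop !rvalE.
Qed.

Lemma rop_antipode r a : R r (S a) = S (L (rS r) a).
Proof.
apply: (rval_inj HD) => l.
by rewrite rval_rop lop_antipode -!rval_antipode -rval_rop.
Qed.

Let X2h s : X2 s h h = h \ox h.
Proof.
have hE := cov2_group_like; case: s => //.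
by have [_ _ h_star _] := Hh; rewrite -[X2 _ _ _]starK star_cov2 h_star hE star_tens h_star.
Qed.

Lemma antipode_group_like : S h = h.
Proof. by have := strong h h; rewrite !ropE !X2h rslice_tens phih scale1r. Qed.
Let Sh := antipode_group_like.
Let S'h : S' h = h. Proof. by rewrite -{1}Sh SK. Qed.

(** As [S] fixes [h] and reverses the coproduct, the group-like identity moves to the other leg. *)
Let X1h s : X1 s h h = h \ox h.
Proof.
apply: tensor_lslice_eq => f; rewrite -[LHS](lopE HD (Rfun f s h)) -{2}Sh.
rewrite lop_antipode ropE /= S'h X2h rslice_tens lslice_tens /= linearZ /= Sh.
by [].
Qed.

(** The right invariance of phi S, in sliced form. *)
Lemma phi_antipode_rop f s b x : phi (S (R (Rfun f s b) x)) = phi (S x) * f b.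
Proof.
rewrite -[in RHS](SK b) -[f (S' _)]/((f \o S') (S b)) -(phi_lop HD phi_inv _ (~~ s)).
rewrite lop_antipode; congr (phi (S _)); apply: rop_ext => y.
by rewrite !rvalE /= SK negbK SK.
Qed.

(** * The functional phi(. h) *)

Let omega s := Rfun phi s h.

(** The left side is the slice by phi of Delta(a) (h (x) h) = Delta(a h) (h (x) 1), to which left
    invariance applies. *)
Let rop_mulh a : R (omega false) a ** h = phi (a ** h) *: h.
Proof.
rewrite -(rslice_phi_cov1 HD phi_inv false) cov1Ml X1h -(X2h false) -cov2Ml.
by rewrite cov2Ml X2h lact_DeltaE rslice_mulb1 ropE.
Qed.

Let rop_hmul a : h ** R (omega true) a = phi (h ** a) *: h.
Proof.
rewrite -(rslice_phi_cov1 HD phi_inv true) cov1Mr X1h -(X2h true) -cov2Mr.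
by rewrite cov2Mr X2h ract_DeltaE rslice_mulb1 ropE.
Qed.

(** Two evaluations of phi S at a1 h phi(a2 h): by the right invariance of phi S, and by
    [rop_mulh]. *)
Let phi_mulh_S a : phi (h ** S a) = phi (a ** h).
Proof.
have := phi_antipode_rop phi false h (a ** h).
rewrite ropE /= cov2Ml X2h lact_DeltaE rslice_mulb1 -[rslice _ _](ropE HD (omega false)).
by rewrite /mulb rop_mulh !linearZ /= Sh phih !mulr1 SM Sh => ->.
Qed.

Let phi_hmul_S a : phi (S a ** h) = phi (h ** a).
Proof.
have := phi_antipode_rop phi true h (h ** a).
rewrite ropE /= cov2Mr X2h ract_DeltaE rslice_mulb1 -[rslice _ _](ropE HD (omega true)).
by rewrite /mulb rop_hmul !linearZ /= Sh phih !mulr1 SM Sh => ->.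
Qed.

Let phi_hmul_rop a : phi (h ** R (omega false) a) = phi (a ** h).
Proof.
rewrite -phi_hmul_S strong -[LHS](rvalE phi false h) rval_rop rvalE lopE X1h.
by rewrite lslice_tens phih scale1r.
Qed.

(* With w = phi(. h), one has w S = phi(h .) and phi(h .) * w = w (convolution).
   As S reverses convolutions and exchanges w and phi(h .), it fixes the
   left-hand side of the latter, so that w = w S = phi(h .). *)
Lemma phi_mulhC a : phi (h ** a) = phi (a ** h).
Proof.
rewrite -phi_hmul_S -phi_hmul_rop rop_antipode phi_mulh_S.
rewrite -[LHS](rvalE phi false h) -rval_rop rval_antipode rvalE /=.
by rewrite phi_hmul_S phi_hmul_rop.
Qed.

Let omegaE s s' x : rval (omega s) x = rval (omega s') x.
Proof. by rewrite !rvalE; case: s s' => -[]; rewrite /mulb// phi_mulhC. Qed.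
Let omegaS s x : rval (rS (omega s)) x = rval (omega s) x.
Proof.
rewrite rval_antipode !(omegaE s false) !rvalE /mulb phi_hmul_S; exact: phi_mulhC.
Qed.

(** * The conditional expectations E and E' *)

Definition cexpr : {linear A -> A} := R (omega false).
Definition cexpl : {linear A -> A} := L (omega false).
Local Notation E := cexpr.
Local Notation E' := cexpl.

Lemma cexprE s a : E a = R (omega s) a. Proof. exact/rop_ext/omegaE. Qed.
Lemma cexpr_antipode a : E (S a) = S (E' a).
Proof. by rewrite rop_antipode; congr (S _); apply/lop_ext/omegaS. Qed.
Lemma cexpl_antipode a : E' (S a) = S (E a).
Proof. by rewrite lop_antipode; congr (S _); apply/rop_ext/omegaS. Qed.

Lemma lop_cexpr r a : L r (E a) = E (L r a).
Proof. exact: lop_rop. Qed.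
Lemma rop_cexpl r a : R r (E' a) = E' (R r a).
Proof. exact/esym/lop_rop. Qed.

Lemma cexplr a : E' (E a) = E (E' a).
Proof. exact: lop_rop. Qed.

Lemma cexpr_star a : E (star a) = star (E a).
Proof.
have [_ _ h_star _] := Hh.
by rewrite [in RHS](cexprE true) star_rop_phi /= h_star -(cexprE false).
Qed.

Lemma antipode_star a : S (star a) = star (S' a).
Proof. by rewrite antipode_invE starK. Qed.

Lemma cexplE_antipode a : E' a = S (E (S' a)).
Proof. by rewrite -cexpl_antipode S'K. Qed.

Lemma cexpl_star a : E' (star a) = star (E' a).
Proof.
have S'star b : S' (star b) = star (S b) by rewrite antipode_invE starK.
by rewrite [LHS]cexplE_antipode S'star cexpr_star antipode_star cexpr_antipode SK.
Qed.

(** The sliced form of Delta(c) (1 (x) h) = c (x) h for [c] in the range of [E]: since [E] commutes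
    with L_l, the second leg is some E(x) times [h], a multiple of [h]. *)
Lemma rop_cexpr f s a : R (Rfun f s h) (E a) = f h *: E a.
Proof.
apply: (rval_inj HD) => l; rewrite rval_rop lop_cexpr rvalE [RHS]linearZ.
have -> : mulb s h (E (L l a)) = rval (omega false) (L l a) *: h.
  by rewrite (cexprE s) (omegaE false s); case: s; rewrite /mulb ?rop_hmul ?rop_mulh.
by rewrite [LHS]linearZ -rval_rop [LHS]mulrC.
Qed.

Lemma cexpr_idem a : E (E a) = E a.
Proof. by rewrite [LHS]rop_cexpr phih scale1r. Qed.
Lemma cexpl_idem a : E' (E' a) = E' a.
Proof. by rewrite -[a]S'K !cexpl_antipode cexpr_idem. Qed.

Lemma cov2_cexpr s c : E c = c -> X2 s h c = c \ox h.
Proof.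
move=> Ec; apply: tensor_rslice_eq => f.
by rewrite -[LHS](ropE HD (Rfun f s h)) rslice_tens -{1}Ec rop_cexpr Ec.
Qed.

(** Delta(a c) (1 (x) h) = Delta(a) (c (x) h), so [c] comes out of the slice. *)
Lemma cexprMr a c : E c = c -> E (a ** c) = E a ** c.
Proof.
move=> Ec; rewrite !ropE /= cov2Ml (cov2_cexpr _ Ec) lact_DeltaE.
exact: rslice_mulb1.
Qed.
Lemma cexprMl a c : E c = c -> E (c ** a) = c ** E a.
Proof.
move=> Ec; rewrite !(cexprE true) !ropE /= cov2Mr (cov2_cexpr _ Ec) ract_DeltaE.
exact: rslice_mulb1.
Qed.

Let cexpr_S' c : E' c = c -> E (S' c) = S' c.
Proof. by move=> Ec; apply: (can_inj SK); rewrite -cexpl_antipode S'K. Qed.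
Let S'M a b : S' (a ** b) = S' b ** S' a.
Proof. by apply: (can_inj SK); rewrite SM !S'K. Qed.

Lemma cexplMr a c : E' c = c -> E' (a ** c) = E' a ** c.
Proof.
move=> /cexpr_S' Ec; rewrite cexplE_antipode S'M cexprMl// SM S'K.
by rewrite -cexplE_antipode.
Qed.
Lemma cexplMl a c : E' c = c -> E' (c ** a) = c ** E' a.
Proof.
move=> /cexpr_S' Ec; rewrite cexplE_antipode S'M cexprMr// SM S'K.
by rewrite -cexplE_antipode.
Qed.

Lemma cexpr_h : E h = h.
Proof. by rewrite ropE X2h rslice_tens phih scale1r. Qed.
Lemma cexpl_h : E' h = h.
Proof. by rewrite lopE X1h lslice_tens phih scale1r. Qed.

Lemma phi_cexpl a : phi (E' a) = phi a.
Proof. by rewrite (phi_lop HD phi_inv) phih mulr1. Qed.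

(** The fixed points of [E] contain the right leg because E(h) = h and [E] commutes with every left
    slice; minimality gives one inclusion. *)
Lemma right_legP C : is_right_leg Delta h C -> forall c, (c \in C) = (E c == c).
Proof.
move=> [[C0 Clin] Cleg Cmin] c; apply/idP/idP; last first.
  move=> /eqP Ec; rewrite -Ec.
  (* Strong left invariance trades [c] for [h] as the sliced element: E(c) is a left slice of
     Delta(h), so it lies in [C]. *)
  have -> : E c = L (rS (Rfun phi true c)) h.
    by apply: (can_inj SK); rewrite strong -{1}Sh rop_antipode.
  have [s /allP sC sE] := Cleg (S' c).
  have -> : L (rS (Rfun phi true c)) h = \sum_(p <- s) phi (S p.1) *: p.2.
    rewrite lopE /= -[X1 _ _ _](to_multK _ ndAA) cov1E /mulm -sE (to_multK _ ndAA).
    by rewrite (linear_sum (lslice _)); apply: eq_bigr => p _; rewrite /= lslice_tens.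
  rewrite big_seq; elim/big_ind: _ => //= [x y Cx Cy|p /sC Cp].
    by rewrite -[x]scale1r; apply: Clin.
  by rewrite -[_ *: _]addr0; apply: Clin.
pose V : {pred A} := [pred c | E c == c].
apply: (Cmin V).
  split=> [|k x y]; first by rewrite inE linear0.
  by rewrite !inE linearP => /eqP-> /eqP->.
move=> a; have [||s sV sE] :=
    tensor_rleg (x := X1 false a h) (@separatingT _ _) (V := V).
- split=> [|k x y]; first by rewrite inE linear0.
  by rewrite !inE linearP => /eqP-> /eqP->.
- move=> f _; rewrite inE -[lslice f _](lopE HD (Rfun f false a)).
  by rewrite -lop_cexpr cexpr_h.
by exists s => //; rewrite -sE cov1E.
Qed.

Lemma C1P C : is_right_leg Delta h C ->
  C1 S C =i [pred c | (E c == c) && (E' c == c)].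
Proof.
move=> HC a; rewrite !inE (right_legP HC); apply: andb_id2l => /eqP Ea.
apply/asboolP/eqP => [[c]|E'a].
  by rewrite (right_legP HC) => /eqP Ec ->; rewrite cexpl_antipode Ec.
by exists (S' a); rewrite ?S'K// (right_legP HC) cexpr_S'.
Qed.

Lemma cov2_cexpl s b a : tmap E' idfun (X2 s b a) = X2 s b (E' a).
Proof.
apply: tensor_rslice_eq => f; rewrite rslice_tmap -[RHS](ropE HD (Rfun f s b)).
by rewrite rop_cexpl ropE.
Qed.

Lemma cov1_cexpr s b a : tmap idfun E (X1 s b a) = X1 s b (E a).
Proof.
apply: tensor_lslice_eq => f; rewrite lslice_tmap -[RHS](lopE HD (Rfun f s b)).
by rewrite lop_cexpr lopE.
Qed.

Lemma cexprM s c a : E c = c -> E (mulb s c a) = mulb s c (E a).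
Proof.
move=> Ec; case: s; rewrite /mulb.
  exact: cexprMl.
exact: cexprMr.
Qed.

Lemma cexplM s c a : E' c = c -> E' (mulb s c a) = mulb s c (E' a).
Proof.
move=> Ec; case: s; rewrite /mulb.
  exact: cexplMl.
exact: cexplMr.
Qed.

(** [E] meets the product of [b] with a left slice of [a] and passes [b] by the module property. *)
Lemma cov2_cexprM s b a : E b = b -> tmap idfun E (X2 s b a) = X2 s b (E a).
Proof.
move=> Eb; apply: (tensor_lval_eq HD) => f c; set r := Rfun f false c.
rewrite lslice_tmap [RHS](lslice_cov2 HD r) lop_cexpr -cexprM//.
by rewrite -[X in _ = E X](lslice_cov2 HD r).
Qed.

Lemma cov1_cexplM s b a : E' b = b -> tmap E' idfun (X1 s b a) = X1 s b (E' a).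
Proof.
move=> Eb; apply: (tensor_rval_eq HD) => f c; set r := Rfun f false c.
rewrite rslice_tmap [RHS](rslice_cov1 HD r) rop_cexpl -cexplM//.
by rewrite -[X in _ = E' X](rslice_cov1 HD r).
Qed.

(** Both sides slice a1 (x) a2 (x) a3 by [r], phi(. h) and [u]. This is the source of (E (x) iota)
    Delta = (iota (x) E') Delta. *)
Let val_cexp r u a : rval r (E (R u a)) = rval u (E' (L r a)).
Proof. by rewrite rval_rop lop_rop rval_rop. Qed.

Lemma cov2_cexp s b a : E' b = b -> tmap idfun E' (X2 s b a) = tmap E idfun (X2 s b a).
Proof.
move=> Eb; apply: (tensor_lval_eq HD) => f c; set r := Rfun f false c.
rewrite !lslice_tmap [lslice (rval r \o idfun) _](lslice_cov2 HD r) cexplM//.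
apply: functional_eq => g; rewrite [RHS]slice_comm.
rewrite -[rslice g _](ropE HD (Rfun g s b)) -[RHS]/(rval r (E _)) val_cexp.
by rewrite rvalE.
Qed.

Lemma cov1_cexp s b a : E b = b -> tmap E idfun (X1 s b a) = tmap idfun E' (X1 s b a).
Proof.
move=> Eb; apply: (tensor_rval_eq HD) => f c; set u := Rfun f false c.
rewrite !rslice_tmap [rslice (rval u \o idfun) _](rslice_cov1 HD u) cexprM//.
apply: functional_eq => g; rewrite -[RHS]slice_comm.
rewrite -[lslice g _](lopE HD (Rfun g s b)) -[RHS]/(rval u (E' _)) -val_cexp.
by rewrite rvalE.
Qed.

(** * The algebra C1 and its coproduct *)

Definition C1_pred : pred A := fun c => (E c == c) && (E' c == c).

Lemma C1_predP c : reflect (E c = c /\ E' c = c) (C1_pred c).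
Proof.
by apply: (iffP andP) => [[/eqP Ec /eqP E'c]|[Ec E'c]]; split=> //; apply/eqP.
Qed.

Lemma C1_pred_submod : submod_closed C1_pred.
Proof.
split=> [|k x y]; first by apply/C1_predP; rewrite !linear0.
by move=> /C1_predP[Ex E'x] /C1_predP[Ey E'y]; apply/C1_predP; rewrite !linearP Ex Ey E'x E'y.
Qed.

Lemma C1_pred_mul a b : C1_pred a -> C1_pred b -> C1_pred (a ** b).
Proof.
move=> /C1_predP[Ea E'a] /C1_predP[Eb E'b]; apply/C1_predP.
by rewrite (cexprM true b Ea) (cexplM true b E'a) /mulb /= Eb E'b.
Qed.

Definition C1_alg : subalgebra A := Subalgebra C1_pred_submod C1_pred_mul.
Local Notation D := (sub_alg C1_alg).

Lemma C1_algP (d : D) : E (sub_val d) = sub_val d /\ E' (sub_val d) = sub_val d.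
Proof. exact/C1_predP/(valP d). Qed.

Let EE' a : E' (E a) = E (E' a). Proof. exact: cexplr. Qed.

Let proj_subproof a : C1_pred (E (E' a)).
Proof.
apply/C1_predP; rewrite cexpr_idem -EE'.
by rewrite cexpl_idem.
Qed.

Let proj_linear : linear (fun a => SubAlg (D := C1_alg) (proj_subproof a)).
Proof. by move=> k a b; apply: val_inj; rewrite /= !linearP. Qed.

Definition C1_proj : {linear A -> D} := mk_linear proj_linear.
Local Notation p := C1_proj.
Local Notation v := (@sub_val K A C1_alg).

Lemma C1_projE a : v (p a) = E (E' a).
Proof. by rewrite mk_linearE. Qed.

Let inclM (d e : D) : v (d ** e) = v d ** v e. Proof. by []. Qed.
Let inclK : cancel v p.
Proof. by move=> d; apply: val_inj; rewrite /= C1_projE; have [Ed ->] := C1_algP d. Qed.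
Let projMl d a : p (v d ** a) = d ** p a.
Proof.
apply: val_inj; rewrite /= !C1_projE; have [Ed E'd] := C1_algP d.
by rewrite (cexplM true _ E'd) (cexprM true _ Ed).
Qed.
Let projMr a d : p (a ** v d) = p a ** d.
Proof.
apply: val_inj; rewrite /= !C1_projE; have [Ed E'd] := C1_algP d.
by rewrite (cexplM false _ E'd) (cexprM false _ Ed).
Qed.

Definition C1_ce : cond_expectation A D := CondExpectation inclM inclK projMl projMr.
Local Notation ce2 := (ce_tensor C1_ce C1_ce).

Let proj_cexpr a : p (E a) = p a.
Proof.
by apply: val_inj; rewrite /= !C1_projE EE' cexpr_idem.
Qed.
Let proj_cexpl a : p (E' a) = p a.
Proof.
by apply: val_inj; rewrite /= !C1_projE cexpl_idem.
Qed.

Definition C1_Delta : {linear D -> mult (tensor D D)} :=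
  mk_linear (linearP (compress ce2 \o Delta \o v)).
Local Notation Delta1 := C1_Delta.

Lemma C1_DeltaE d : Delta1 d = compress ce2 (Delta (v d)).
Proof. exact: mk_linearE. Qed.

Lemma compress_mulm s d e m : ce_compatible ce2 d e ->
  compress ce2 (mulm s d m) = mulm s e (compress ce2 m).
Proof. by case: s => c; rewrite /mulm; [apply: compress_mull|apply: compress_mulr]. Qed.

Lemma C1_Delta_side2 s b d :
  mulm s (mr b) (Delta1 d) = to_mult (tmap p p (X2 s (v b) (v d))).
Proof.
rewrite -[RHS](compress_to_mult ce2) cov2E C1_DeltaE -(@compress_mulm s (mr (v b)) (mr b))//.
by apply: ce_compatible_tens; [exact: ce_compatible1|exact: (ce_compatible_incl C1_ce)].
Qed.

Lemma C1_Delta_side1 s b d :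
  mulm s (ml b) (Delta1 d) = to_mult (tmap p p (X1 s (v b) (v d))).
Proof.
rewrite -[RHS](compress_to_mult ce2) cov1E C1_DeltaE -(@compress_mulm s (ml (v b)) (ml b))//.
by apply: ce_compatible_tens; [exact: (ce_compatible_incl C1_ce)|exact: ce_compatible1].
Qed.

Let tmapC (f g : {linear A -> A}) x :
  tmap f idfun (tmap idfun g x) = tmap idfun g (tmap f idfun x).
Proof. by rewrite !tmap_comp. Qed.

Let tmap_vp x : tmap v v (tmap p p x) =
  tmap idfun E' (tmap idfun E (tmap E idfun (tmap E' idfun x))).
Proof.
rewrite !tmap_comp.
apply: (tensor_eq (f := tmap (v \o p) (v \o p)) (g := tmap (E \o E') (E' \o E))) => a b.
rewrite -[LHS]/(tmap _ _ _) -[RHS]/(tmap _ _ _) (tmap_tensE (v \o p) (v \o p)).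
by rewrite (tmap_tensE (E \o E') (E' \o E)) /= !C1_projE EE'.
Qed.

(** [E'] in the first leg and [E] in the second pass to the argument [d], which they fix; [E'] in
    the second leg can be traded for [E] in the first. So the compression obeys the defining formula
    of the coproduct of C1. *)
Lemma val_proj_cov2 s (b d : D) : tmap v v (tmap p p (X2 s (v b) (v d))) =
  tmap E idfun (X2 s (v b) (v d)).
Proof.
have [Eb E'b] := C1_algP b; have [Ed E'd] := C1_algP d.
rewrite tmap_vp cov2_cexpl E'd -tmapC cov2_cexprM// Ed -cov2_cexp//.
rewrite tmap_comp; apply: (tensor_eq (f := tmap idfun (E' \o E')) (g := tmap idfun E')).
move=> x y; rewrite -[LHS]/(tmap _ _ _) -[RHS]/(tmap _ _ _).
by rewrite (tmap_tensE idfun (E' \o E')) (tmap_tensE idfun E') /= cexpl_idem.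
Qed.

Lemma val_proj_cov1 s (b d : D) : tmap v v (tmap p p (X1 s (v b) (v d))) =
  tmap E idfun (X1 s (v b) (v d)).
Proof.
have [Eb E'b] := C1_algP b; have [Ed E'd] := C1_algP d.
rewrite tmap_vp -2!tmapC cov1_cexplM// E'd cov1_cexpr Ed -cov1_cexp//.
rewrite tmap_comp; apply: (tensor_eq (f := tmap (E \o E) idfun) (g := tmap E idfun)).
move=> x y; rewrite -[LHS]/(tmap _ _ _) -[RHS]/(tmap _ _ _).
by rewrite (tmap_tensE (E \o E) idfun) (tmap_tensE E idfun) /= cexpr_idem.
Qed.

Lemma C1_pred_star c : C1_pred c -> C1_pred (star c).
Proof.
move=> /C1_predP[Ec E'c]; apply/C1_predP; split.
  by rewrite cexpr_star Ec.
by rewrite cexpl_star E'c.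
Qed.

(** * The hypergroup axioms for C1 *)

Let phiD : {scalar D} := phi \o v.
Let epsD : {scalar D} := eps \o v.

(** The adjoint of [b] is again in C1 and serves as test element. *)
Lemma C1_faithful : Defs.faithful phiD.
Proof.
move=> b; pose b' : D := SubAlg (D := C1_alg) (C1_pred_star (valP b)).
have vb0 x : v x = 0 -> x = 0 by move=> x0; apply: val_inj.
split=> [/(_ b')|/(_ b')] /= b0; apply: vb0.
  exact: phi_faithful.
apply: (inv_inj (@starK _ A)); rewrite star0.
by apply: phi_faithful; rewrite starK.
Qed.

Lemma C1_nondegenerate : nondegenerate D.
Proof.
move=> a; have [Hl Hr] := C1_faithful a.
by split=> a0; [apply: Hr|apply: Hl] => b; rewrite a0 linear0.
Qed.
Let ndD := C1_nondegenerate.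
Let ndDD : nondegenerate (tensor D D) := tensor_nondegenerate ndD ndD.

Let val_lslice (w : {scalar A}) (y : tensor D D) :
  v (lslice (w \o v) y) = lslice w (tmap v v y).
Proof. by rewrite lslice_tmap. Qed.
Let val_rslice (w : {scalar A}) (y : tensor D D) :
  v (rslice (w \o v) y) = rslice w (tmap v v y).
Proof. by rewrite rslice_tmap. Qed.

Lemma of_mult_side2 s b d :
  of_mult (mulm s (mr b) (Delta1 d)) = tmap p p (X2 s (v b) (v d)).
Proof. by rewrite C1_Delta_side2 to_multK. Qed.
Lemma of_mult_side1 s b d :
  of_mult (mulm s (ml b) (Delta1 d)) = tmap p p (X1 s (v b) (v d)).
Proof. by rewrite C1_Delta_side1 to_multK. Qed.

Let val_mulb s (b d : D) : v (mulb s b d) = mulb s (v b) (v d).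
Proof. by case: s. Qed.

(** [E] is moved from the first leg to [E'] in the second, so that the counit meets [Delta]
    itself. *)
Lemma lslice_eps_side2 s b d :
  lslice epsD (of_mult (mulm s (mr b) (Delta1 d))) = mulb s b d.
Proof.
have [Eb E'b] := C1_algP b; have [Ed E'd] := C1_algP d.
apply: val_inj; rewrite [LHS]val_lslice of_mult_side2 val_proj_cov2 -cov2_cexp//.
rewrite lslice_tmap -[lslice (eps \o idfun) _]/(lslice eps _).
by rewrite (lslice_eps_cov2 HD Heps) cexplM// E'd -val_mulb.
Qed.

Lemma rslice_eps_side1 s b d :
  rslice epsD (of_mult (mulm s (ml b) (Delta1 d))) = mulb s b d.
Proof.
have [Eb E'b] := C1_algP b; have [Ed E'd] := C1_algP d.
apply: val_inj; rewrite [LHS]val_rslice of_mult_side1 val_proj_cov1.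
rewrite rslice_tmap -[rslice (eps \o idfun) _]/(rslice eps _).
by rewrite (rslice_eps_cov1 HD Heps) cexprM// Ed -val_mulb.
Qed.

Lemma C1_counit : is_counit Delta1 epsD.
Proof.
split=> [a b|a]; first exact: (Heps.1 (v a) (v b)).
split=> b; split.
- exact: (lslice_eps_side2 false).
- exact: (lslice_eps_side2 true).
- exact: (rslice_eps_side1 false).
- exact: (rslice_eps_side1 true).
Qed.

Lemma rslice_phi_side1 s b d :
  rslice phiD (of_mult (mulm s (ml b) (Delta1 d))) = phiD d *: b.
Proof.
have [Eb E'b] := C1_algP b.
apply: val_inj; rewrite [LHS]val_rslice of_mult_side1 val_proj_cov1.
rewrite rslice_tmap -[rslice (phi \o idfun) _]/(rslice phi _).
by rewrite (rslice_phi_cov1 HD phi_inv) linearZ /= Eb.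
Qed.

Lemma C1_left_invariant : left_invariant Delta1 phiD.
Proof.
move=> a b; split; first exact: (rslice_phi_side1 false).
exact: (rslice_phi_side1 true).
Qed.

(** With the projection moved to the second leg and phi E' = phi, slices of the new coproduct by phi
    are those of [Delta]; strong left invariance therefore restricts to C1. *)
Lemma rslice_phi_side2 s b d :
  v (rslice phiD (of_mult (mulm s (mr b) (Delta1 d)))) = R (Rfun phi s (v b)) (v d).
Proof.
have [Eb E'b] := C1_algP b.
rewrite [LHS]val_rslice of_mult_side2 val_proj_cov2 -cov2_cexp// rslice_tmap ropE.
by apply: rslice_ext => x /=; rewrite phi_cexpl.
Qed.

Lemma C1_pred_antipode c : C1_pred c -> C1_pred (S c).
Proof.
move=> /C1_predP[Ec E'c]; apply/C1_predP.
by rewrite cexpr_antipode cexpl_antipode Ec E'c.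
Qed.

Lemma C1_pred_antipode_inv c : C1_pred c -> C1_pred (S' c).
Proof.
move=> /C1_predP[Ec E'c]; apply/C1_predP.
split; apply: (can_inj SK).
  by rewrite -cexpl_antipode S'K.
by rewrite -cexpr_antipode S'K.
Qed.

Let SD_linear :
  linear (fun d : D => SubAlg (D := C1_alg) (C1_pred_antipode (valP d))).
Proof. by move=> k a b; apply: val_inj; rewrite /= linearP. Qed.
Definition C1_antipode : {linear D -> D} := mk_linear SD_linear.

Let C1_antipodeE d : v (C1_antipode d) = S (v d).
Proof. by rewrite mk_linearE. Qed.

Lemma C1_antipode_relative : is_antipode_relative Delta1 phiD C1_antipode.
Proof.
split.
- exists (fun d : D => SubAlg (D := C1_alg) (C1_pred_antipode_inv (valP d))) => d;
    apply: val_inj; rewrite /= ?C1_antipodeE /= ?C1_antipodeE.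
    exact: SK.
  exact: S'K.
- by move=> a b; apply: val_inj; rewrite /= !C1_antipodeE; apply: HS.1.
- move=> a b; apply: val_inj; rewrite /= !C1_antipodeE.
  rewrite [in LHS](rslice_phi_side2 false) [RHS](rslice_phi_side2 true).
  exact: strong.
Qed.

Lemma C1_range a b : [/\ Defs.in_alg (Delta1 a * mr b), Defs.in_alg (ml a * Delta1 b),
  Defs.in_alg (Delta1 a * ml b) & Defs.in_alg (mr a * Delta1 b)].
Proof.
split; eexists; apply: esym.
- exact: (C1_Delta_side2 false).
- exact: (C1_Delta_side1 true).
- exact: (C1_Delta_side1 false).
- exact: (C1_Delta_side2 true).
Qed.

(** For [b] in C1, [E] passes from [x] to the second leg of Delta(x) (1 (x) b), where the projection
    absorbs it. *)
Lemma compress_cexpr x : compress ce2 (Delta (E x)) = compress ce2 (Delta x).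
Proof.
have tpE y : tmap p p (tmap idfun E y) = tmap p p y.
  rewrite tmap_comp; apply: (tensor_eq (f := tmap (p \o idfun) (p \o E)) (g := tmap p p)).
  move=> a b; rewrite -[LHS]/(tmap _ _ _) -[RHS]/(tmap _ _ _).
  by rewrite (tmap_tensE (p \o idfun) (p \o E)) (tmap_tensE p p) /= proj_cexpr.
have tensE (a b : D) : ce_incl ce2 (a \ox b) = v a \ox v b.
  exact: (tmap_tensE (ce_incl C1_ce) (ce_incl C1_ce)).
apply: tensor_mult_ext => a b; have [Eb E'b] := C1_algP b.
  rewrite !lact_compress tensE !(lact_DeltaE HD) -cov2_cexprM// mulb1_tmap.
  exact: tpE.
rewrite !ract_compress tensE !(ract_DeltaE HD) -cov2_cexprM// mulb1_tmap.
exact: tpE.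
Qed.

Lemma compress_cexpl x : compress ce2 (Delta (E' x)) = compress ce2 (Delta x).
Proof.
have tpE y : tmap p p (tmap E' idfun y) = tmap p p y.
  rewrite tmap_comp; apply: (tensor_eq (f := tmap (p \o E') (p \o idfun)) (g := tmap p p)).
  move=> a b; rewrite -[LHS]/(tmap _ _ _) -[RHS]/(tmap _ _ _).
  by rewrite (tmap_tensE (p \o E') (p \o idfun)) (tmap_tensE p p) /= proj_cexpl.
have tensE (a b : D) : ce_incl ce2 (a \ox b) = v a \ox v b.
  exact: (tmap_tensE (ce_incl C1_ce) (ce_incl C1_ce)).
apply: tensor_mult_ext => a b; have [Ea E'a] := C1_algP a.
  rewrite !lact_compress tensE !(lact_DeltaE HD) !mulb1_cov2 -cov1_cexplM// mulb2_tmap.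
  exact: tpE.
rewrite !ract_compress tensE !(ract_DeltaE HD) !mulb1_cov2 -cov1_cexplM// mulb2_tmap.
exact: tpE.
Qed.

Let to_multA : {linear A -> mult A} := @to_mult K A.
Let to_multD : {linear D -> mult D} := @to_mult K D.

Lemma compress_Delta_l x : compress (ce_tensor ce2 C1_ce) (Delta_l Delta x) =
  tens_mult_map (compress ce2 \o Delta) (to_multD \o p) x.
Proof.
rewrite -[Delta_l _ _](tens_mult_mapE Delta to_multA).
apply: (tensor_eq (f := compress (ce_tensor ce2 C1_ce) \o tens_mult_map Delta to_multA)
  (g := tens_mult_map (compress ce2 \o Delta) (to_multD \o p))) => a b.
rewrite [LHS]/= !tens_mult_map_tens compress_tens.
by congr (_ \oxm _); apply: (compress_to_mult C1_ce).
Qed.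

Lemma compress_Delta_r x : compress (ce_tensor C1_ce ce2) (Delta_r Delta x) =
  tens_mult_map (to_multD \o p) (compress ce2 \o Delta) x.
Proof.
rewrite -[Delta_r _ _](tens_mult_mapE to_multA Delta).
apply: (tensor_eq (f := compress (ce_tensor C1_ce ce2) \o tens_mult_map to_multA Delta)
  (g := tens_mult_map (to_multD \o p) (compress ce2 \o Delta))) => a b.
rewrite [LHS]/= !tens_mult_map_tens compress_tens.
by congr (_ \oxm _); apply: (compress_to_mult C1_ce).
Qed.

(** The [E] in the first leg of the inner coproduct is invisible to the compression of the outer
    one, so iterating the new coproduct amounts to compressing the iterate of [Delta]. *)
Lemma C1_Delta_l s b d :
  Delta_l Delta1 (of_mult (mulm s (mr b) (Delta1 d))) =
  compress (ce_tensor ce2 C1_ce) (Delta_l Delta (X2 s (v b) (v d))).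
Proof.
rewrite of_mult_side2 compress_Delta_l -[LHS](tens_mult_mapE Delta1 to_multD).
set T := X2 _ _ _; pose F := tens_mult_map (compress ce2 \o Delta) (to_multD \o p).
have -> y : tens_mult_map Delta1 to_multD y = F (tmap v v y).
  apply: (tensor_eq (f := tens_mult_map Delta1 to_multD) (g := F \o tmap v v)) => a c.
  rewrite [RHS]/= (tmap_tensE v v) !tens_mult_map_tens /= C1_DeltaE.
  by congr (_ \oxm to_mult _); rewrite inclK.
rewrite val_proj_cov2.
apply: (tensor_eq (f := F \o tmap E idfun) (g := F)) => a c.
by rewrite [LHS]/= (tmap_tensE E idfun) !tens_mult_map_tens /= compress_cexpr.
Qed.

Lemma C1_Delta_r s b d :
  Delta_r Delta1 (of_mult (mulm s (ml b) (Delta1 d))) =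
  compress (ce_tensor C1_ce ce2) (Delta_r Delta (X1 s (v b) (v d))).
Proof.
have [Eb E'b] := C1_algP b.
rewrite of_mult_side1 compress_Delta_r -[LHS](tens_mult_mapE to_multD Delta1).
set T := X1 _ _ _; pose F := tens_mult_map (to_multD \o p) (compress ce2 \o Delta).
have -> y : tens_mult_map to_multD Delta1 y = F (tmap v v y).
  apply: (tensor_eq (f := tens_mult_map to_multD Delta1) (g := F \o tmap v v)) => a c.
  rewrite [RHS]/= (tmap_tensE v v) !tens_mult_map_tens /= C1_DeltaE.
  by congr (to_mult _ \oxm _); rewrite inclK.
(* Here the outer coproduct acts on the second leg, so the projection is first moved there as
   [E']. *)
rewrite val_proj_cov1 cov1_cexp//.
apply: (tensor_eq (f := F \o tmap idfun E') (g := F)) => a c.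
by rewrite [LHS]/= (tmap_tensE idfun E') !tens_mult_map_tens /= compress_cexpl.
Qed.

Lemma C1_coassociative : coassociative Delta1.
Proof.
move=> a b c.
rewrite -[Delta1 a * mr b]/(mulm false (mr b) (Delta1 a)) C1_Delta_l.
rewrite -[ml c * Delta1 a]/(mulm true (ml c) (Delta1 a)) C1_Delta_r.
have to_multP d : ce_compatible C1_ce (to_mult (v d)) (to_mult d).
  exact: (ce_compatible_incl C1_ce).
have oneP : ce_compatible C1_ce 1 1 by [].
rewrite -(compress_mull _ (ce_compatible_tens (ce_compatible_tens (to_multP c) oneP) oneP)).
rewrite -(compress_mulr _ (ce_compatible_tens oneP (ce_compatible_tens oneP (to_multP b)))).
apply: compress_assoc; rewrite cov2_of_mult cov1_of_mult.
exact: (mhs_coassociative HD).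
Qed.

Lemma C1_compressed : is_compressed_coproduct Delta (cond_exp Delta phi h) Delta1.
Proof.
have -> : cond_exp Delta phi h = E :> (A -> A).
  by apply: funext => x; rewrite ropE cov2_of_mult.
move=> a b; split.
- exists (tmap p p (X2 false (v b) (v a))); first exact/esym/(C1_Delta_side2 false).
  by rewrite val_proj_cov2 cov2_of_mult.
- exists (tmap p p (X2 true (v b) (v a))); first exact/esym/(C1_Delta_side2 true).
  by rewrite val_proj_cov2 cov2_of_mult.
Qed.

Lemma C1_hypergroup : algebraic_quantum_hypergroup Delta1.
Proof.
split.
- exact: C1_nondegenerate.
- exact: C1_range.
- exact: C1_coassociative.
- by exists epsD; exact: C1_counit.
- exists phiD; first by split; [exact: C1_left_invariant|exact: C1_faithful].
  by exists C1_antipode; exact: C1_antipode_relative.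
Qed.

Let C1_pred_h : C1_pred h.
Proof.
by apply/C1_predP; rewrite cexpr_h cexpl_h.
Qed.

(** The counit applied to the first leg of Delta(a) (1 (x) h) = a (x) h gives a h = eps(a) h. *)
Lemma C1_discrete : discrete_type Delta1.
Proof.
exists epsD; first exact: C1_counit.
exists (SubAlg (D := C1_alg) C1_pred_h).
  by apply/eqP => /(congr1 v); have [/eqP h0 _ _ _] := Hh.
move=> a; have [Ea _] := C1_algP a; apply: val_inj => /=.
have := lslice_eps_cov2 HD Heps false h (v a).
by rewrite (cov2_cexpr _ Ea) lslice_tens.
Qed.

End GroupLikeProjection.

Theorem theorem3p17 (R : realType) (A : starAlgType R[i])
    (Delta : {linear A -> mult (tensor A A)})
    (eps : {scalar A}) (S : {linear A -> A}) (phi : {scalar A})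
    (h : A) (C : {pred A}) :
  multiplier_Hopf_star Delta ->
  is_counit Delta eps ->
  is_antipode Delta eps S ->
  positive_left_integral Delta phi ->
  group_like_projection Delta h ->
  phi h = 1 ->
  is_right_leg Delta h C ->
  exists2 D : subalgebra A, sub_pred D =i C1 S C &
  exists2 Delta1 : {linear sub_alg D -> mult (tensor (sub_alg D) (sub_alg D))},
    is_compressed_coproduct Delta (cond_exp Delta phi h) Delta1 &
    algebraic_quantum_hypergroup Delta1 /\ discrete_type Delta1.
Proof.
move=> HD Heps HS Hphi Hh phih HC.
exists (C1_alg HD Heps HS Hphi Hh phih).
  by move=> c; rewrite (C1P HD Heps HS Hphi Hh phih HC).
exists (C1_Delta HD Heps HS Hphi Hh phih); first exact: C1_compressed.
by split; [exact: C1_hypergroup|exact: C1_discrete].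
Qed.
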